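(* Let $X$ be an $L$-space with a convexifying operator $P$, $T\subset\mathbb R^d$ ($d\in\mathbb N$) a convex compact set with the Euclidean metric $r$ and Lebesgue measure $\mu$, $\omega$ a modulus of continuity, $x_1,\dots,x_n\in T$, and $B_i$ the closed ball of radius $\varepsilon>0$ centered at $x_i$, with $B_i\subset T$, $i=1,\dots,n$. Consider the operator $f\mapsto P\circ f$ from $H^\omega(T,X)$ to $B(T,X)$ (with the uniform metric) and the information $$I(f)=\Big(\tfrac{1}{\mu(B_1)}\int_{B_1}f\,d\mu,\dots,\tfrac{1}{\mu(B_n)}\int_{B_n}f\,d\mu\Big).$$ Then $$\mathcal E(P,H^\omega(T,X),I,B(T,X))\le\max_{t\in T}\min_{i=1,\dots,n}\tfrac{1}{\mu(B_i)}\int_{B_i}\omega(r(t,s))\,d\mu(s).$$ If $X$ is isotropic and $X^{\rm inv}\cap X^{\rm c}\ne\{\theta\}$, then this inequality becomes an equality for all sufficiently small radii $\varepsilon>0$, and in this case the method $$\Phi^*(I(f))(t)=\sum_{i=1}^n\Big(\tfrac{1}{\mu(B_i)}\int_{B_i}f\,d\mu\Big)\chi_{T_i}(t)$$ is optimal, where $\tilde T_i=\{t\in T: r(t,x_i)\le r(t,x_j)\ \forall j\ne i\}$, $T_1=\tilde T_1$, $T_j=\tilde T_j\setminus\bigcup_{i=1}^{j-1}\tilde T_i$ for $j\ge2$, and $\chi_{T_i}(t)\,y$ means $y$ for $t\in T_i$ and $\theta$ otherwise.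
   Context: Semilinear space: a set $X$ with addition and multiplication by reals such that for all $x,y,z\in X$, $\alpha,\beta\in\mathbb R$: $x+y=y+x$; $x+(y+z)=(x+y)+z$; there is $\theta$ with $x+\theta=x$; $\alpha(x+y)=\alpha x+\alpha y$; $\alpha(\beta x)=(\alpha\beta)x$; $1\cdot x=x$, $0\cdot x=\theta$. $x$ convex: $(\alpha+\beta)x=\alpha x+\beta x$ for $\alpha,\beta\ge0$ ($X^{\rm c}$); invertible: $x+x'=\theta$ for some $x'$ ($X^{\rm inv}$). $L$-space: semilinear space with complete separable metric $h_X$, $h_X(\alpha x,\alpha y)=|\alpha|h_X(x,y)$, $h_X(x+z,y+z)\le h_X(x,y)$; isotropic if always equality. Convexifying operator: surjective $P\colon X\to X^{\rm c}$ with $h_X(P(x),P(y))\le h_X(x,y)$, $P\circ P=P$, $P(\alpha x+\beta y)=\alpha P(x)+\beta P(y)$. Integral: $f\colon T\to X$ measurable if $h_X(f(\cdot),x)$ is Borel measurable for all $x$; $B(T,X)$ is the set of bounded measurable functions with metric $h_{B(T,X)}(f,g)=\sup_{t\in T}h_X(f(t),g(t))$; for simple bounded $f$ with values $f_i$ on disjoint Borel $T_i$ covering $T$, $\int_Tf\,d\mu=\sum_iP(f_i)\mu(T_i)$; for bounded measurable $f$, the limit of integrals of any uniformly bounded sequence of simple functions converging a.e. to $f$; $\int_Qf\,d\mu=\int_T\chi_Qf\,d\mu$. Modulus of continuity: non-decreasing continuous $\omega\colon[0,\infty)\to[0,\infty)$, $\omega(0)=0$, $\omega(a+b)\le\omega(a)+\omega(b)$;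 $H^\omega(T,X)=\{f: h_X(f(s),f(t))\le\omega(r(s,t))\}$. Optimal recovery: a method is any map $\Phi$ from values of $I$ to $B(T,X)$; its error is $\sup_{f\in H^\omega(T,X)}h_{B(T,X)}(P\circ f,\Phi(I(f)))$; $\mathcal E(P,H^\omega(T,X),I,B(T,X))$ is the infimum over all methods; $\Phi^*$ is optimal if it attains it. *)

(* Defs.v *)
From HB Require Import structures.
From mathcomp Require Import all_boot all_order all_algebra.
From mathcomp Require Import all_classical all_reals all_analysis.
From Stdlib Require Import ClassicalEpsilon.
Set Implicit Arguments. Unset Strict Implicit. Unset Printing Implicit Defensive.
Import Order.TTheory GRing.Theory Num.Theory.
Import numFieldNormedType.Exports.
Local Open Scope classical_set_scope.
Local Open Scope ring_scope.

Record LSpace (R : realType) := {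
  lcar :> Type;
  ladd : lcar -> lcar -> lcar;
  lsmul : R -> lcar -> lcar;
  lzero : lcar;
  hX : lcar -> lcar -> R;
  ladd_comm : forall x y, ladd x y = ladd y x;
  ladd_assoc : forall x y z, ladd x (ladd y z) = ladd (ladd x y) z;
  ladd_zero : forall x, ladd x lzero = x;
  lsmul_addr : forall a x y, lsmul a (ladd x y) = ladd (lsmul a x) (lsmul a y);
  lsmul_mul : forall a b x, lsmul a (lsmul b x) = lsmul (a * b) x;
  lsmul_one : forall x, lsmul 1 x = x;
  lsmul_zero : forall x, lsmul 0 x = lzero;
  hX_eq0 : forall x y, hX x y = 0 <-> x = y;
  hX_sym : forall x y, hX x y = hX y x;
  hX_tri : forall x y z, hX x z <= hX x y + hX y z;
  hX_complete : forall u : nat -> lcar,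
    (forall e, 0 < e -> exists N, forall m k, (N <= m)%N -> (N <= k)%N -> hX (u m) (u k) < e) ->
    exists l, (fun k => hX (u k) l) @ \oo --> 0;
  hX_separable : exists D : nat -> lcar,
    forall x e, 0 < e -> exists k, hX (D k) x < e;
  hX_smul : forall a x y, hX (lsmul a x) (lsmul a y) = `|a| * hX x y;
  hX_add : forall x y z, hX (ladd x z) (ladd y z) <= hX x y
}.

Arguments ladd {R} l _ _.
Arguments lsmul {R} l _ _.
Arguments lzero {R} l.
Arguments hX {R} l _ _.

Section LSpaceDefs.
Variables (R : realType) (X : LSpace R).

Definition is_convex_elt (x : X) : Prop :=
  forall a b : R, 0 <= a -> 0 <= b -> lsmul X (a + b) x = ladd X (lsmul X a x) (lsmul X b x).

Definition is_invertible_elt (x : X) : Prop := exists x' : X, ladd X x x' = lzero X.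

Definition isotropic : Prop :=
  forall x y z : X, hX X (ladd X x z) (ladd X y z) = hX X x y.

Definition inv_conv_nontrivial : Prop :=
  exists x : X, is_invertible_elt x /\ is_convex_elt x /\ x <> lzero X.

Definition convexifying (P : X -> X) : Prop :=
  (forall x, is_convex_elt (P x)) /\
  (forall y, is_convex_elt y -> exists x, P x = y) /\
  (forall x y, hX X (P x) (P y) <= hX X x y) /\
  (forall x, P (P x) = P x) /\
  (forall (a b : R) (x y : X),
      P (ladd X (lsmul X a x) (lsmul X b y)) = ladd X (lsmul X a (P x)) (lsmul X b (P y))).
End LSpaceDefs.

Definition Rd (R : realType) (d : nat) := g_sigma_algebraType (@open 'rV[R]_d).

Definition eucl (R : realType) (d : nat) (s t : 'rV[R]_d) : R :=
  Num.sqrt (\sum_(i < d) (s 0 i - t 0 i) ^+ 2).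

(* Lebesgue measure on the Borel sets of R^d: the (unique) Borel measure
   giving every closed box its volume. *)
Definition is_lebesgue (R : realType) (d : nat) (mu : {measure set (Rd R d) -> \bar R}) : Prop :=
  forall a b : 'rV[R]_d, (forall i, a 0 i <= b 0 i) ->
    mu [set y : Rd R d | forall i, a 0 i <= y 0 i <= b 0 i] = (\prod_(i < d) (b 0 i - a 0 i))%:E.

Definition convex_subset (R : realType) (d : nat) (T : set 'rV[R]_d) : Prop :=
  forall s t, T s -> T t -> forall l : R, 0 <= l <= 1 -> T (l *: s + (1 - l) *: t).

Definition cball (R : realType) (d : nat) (c : 'rV[R]_d) (e : R) : set 'rV[R]_d :=
  [set s | eucl s c <= e].

Definition modulus (R : realType) (omega : R -> R) : Prop :=
  (forall a, 0 <= a -> 0 <= omega a) /\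
  (forall a b, 0 <= a -> a <= b -> omega a <= omega b) /\
  {within [set a : R | 0 <= a], continuous omega} /\
  omega 0 = 0 /\
  (forall a b, 0 <= a -> 0 <= b -> omega (a + b) <= omega a + omega b).

Section Integral.
Variables (R : realType) (X : LSpace R) (P : X -> X) (d : nat)
  (mu : {measure set (Rd R d) -> \bar R}) (T : set (Rd R d)).

(* a simple function given by its values v_i on disjoint Borel sets A_i,
   i < k, covering T *)
Record sdecomp := SDecomp { sd_k : nat; sd_v : nat -> X; sd_A : nat -> set (Rd R d) }.

Definition sd_ok (s : sdecomp) : Prop :=
  (forall i, (i < sd_k s)%N -> measurable (sd_A s i) /\ sd_A s i `<=` T) /\
  (forall i j, (i < sd_k s)%N -> (j < sd_k s)%N -> i <> j -> sd_A s i `&` sd_A s j = set0) /\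
  T `<=` \bigcup_(i in `I_(sd_k s)) sd_A s i.

Definition sd_eval (s : sdecomp) (t : Rd R d) : X :=
  \big[ladd X/lzero X]_(i < sd_k s) (if `[< sd_A s i t >] then sd_v s i else lzero X).

Definition sd_int (s : sdecomp) : X :=
  \big[ladd X/lzero X]_(i < sd_k s) lsmul X (fine (mu (sd_A s i))) (P (sd_v s i)).

Definition approx_seq (f : Rd R d -> X) (sq : nat -> sdecomp) : Prop :=
  (forall m, sd_ok (sq m)) /\
  (exists (x0 : X) (C : R), forall m t, T t -> hX X (sd_eval (sq m) t) x0 <= C) /\
  (exists N : set (Rd R d), measurable N /\ mu N = 0%E /\
     forall t, T t -> ~ N t -> (fun m => hX X (sd_eval (sq m) t) (f t)) @ \oo --> 0).

Definition is_integral (f : Rd R d -> X) (v : X) : Prop :=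
  (exists sq, approx_seq f sq) /\
  (forall sq, approx_seq f sq -> (fun m => hX X (sd_int (sq m)) v) @ \oo --> 0).

Definition integral (f : Rd R d -> X) : X :=
  epsilon (inhabits (lzero X)) (is_integral f).

Definition integral_on (Q : set (Rd R d)) (f : Rd R d -> X) : X :=
  integral (fun t => if `[< Q t >] then f t else lzero X).

Definition in_B (g : Rd R d -> X) : Prop :=
  (exists (x0 : X) (C : R), forall t, T t -> hX X (g t) x0 <= C) /\
  (forall x : X, measurable_fun T (fun t => hX X (g t) x)).

Definition in_H (omega : R -> R) (f : Rd R d -> X) : Prop :=
  forall s t, T s -> T t -> hX X (f s) (f t) <= omega (eucl s t).

Definition info (n : nat) (B : 'I_n -> set (Rd R d)) (f : Rd R d -> X) : 'I_n -> X :=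
  fun i => lsmul X (fine (mu (B i)))^-1 (integral_on (B i) f).

Definition is_method (omega : R -> R) (n : nat) (B : 'I_n -> set (Rd R d))
  (Phi : ('I_n -> X) -> Rd R d -> X) : Prop :=
  forall f, in_H omega f -> in_B (Phi (info B f)).

Definition method_error (omega : R -> R) (n : nat) (B : 'I_n -> set (Rd R d))
  (Phi : ('I_n -> X) -> Rd R d -> X) : \bar R :=
  ereal_sup [set e | exists f t, in_H omega f /\ T t /\
                         e = (hX X (P (f t)) (Phi (info B f) t))%:E].

Definition optimal_error (omega : R -> R) (n : nat) (B : 'I_n -> set (Rd R d)) : \bar R :=
  ereal_inf [set method_error omega B Phi | Phi in is_method omega B].

End Integral.

Definition bound_fun (R : realType) (d : nat) (mu : {measure set (Rd R d) -> \bar R})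
  (omega : R -> R) (n : nat) (B : 'I_n -> set (Rd R d)) (t : 'rV[R]_d) : \bar R :=
  \big[Order.min/+oo%E]_(i < n)
     ((fine (mu (B i)))^-1%:E * \int[mu]_(s in B i) (omega (eucl t s))%:E)%E.

Definition Ttilde (R : realType) (d : nat) (T : set 'rV[R]_d) (n : nat) (x : 'I_n -> 'rV[R]_d)
  (i : 'I_n) : set 'rV[R]_d :=
  [set t | T t /\ forall j : 'I_n, j != i -> eucl t (x i) <= eucl t (x j)].

Definition Tpart (R : realType) (d : nat) (T : set 'rV[R]_d) (n : nat) (x : 'I_n -> 'rV[R]_d)
  (j : 'I_n) : set 'rV[R]_d :=
  Ttilde T x j `\` \bigcup_(i in [set i : 'I_n | (i < j)%N]) Ttilde T x i.

Definition PhiStar (R : realType) (X : LSpace R) (d : nat) (T : set 'rV[R]_d) (n : nat)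
  (x : 'I_n -> 'rV[R]_d) (y : 'I_n -> X) (t : Rd R d) : X :=
  \big[ladd X/lzero X]_(i < n) (if `[< Tpart T x i t >] then y i else lzero X).

(* Main.v *)
Require Import Defs.
From HB Require Import structures.
From mathcomp Require Import all_boot all_order all_algebra.
From mathcomp Require Import all_classical all_reals all_analysis.
From mathcomp Require Import measurable_realfun ring lra.
From Stdlib Require Import ClassicalEpsilon.
Import Order.TTheory GRing.Theory Num.Theory.
Import numFieldNormedType.Exports.
Local Open Scope classical_set_scope.
Local Open Scope ring_scope.

(** Comparing f with the constant f(t) on B_i gives that P(f(t)) and the mean of f over B_i
are at distance at most the mean a_i(t) over B_i of omega(r(t, .)). The means are ordered as
the distances r(t, x_i): reflecting B_i \ B_j in the bisector of x_i and x_j gives B_j \ B_i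
and moves points away from any t closer to x_i. Hence the Voronoi method has error at most
max_t min_i a_i(t). Reflection invariance of the Lebesgue measure mu follows from translation
invariance, since any translation-invariant nu satisfies nu(B) mu(A) = nu(-A) mu(B) by
Fubini, and one can take for A a ball.

For sharpness at t0, put m = min_i a_i(t0) and start from g0 = m - omega(r(t0, .)), whose means
over the balls are nonpositive. Raising g0 to max(g0, c_i) on B_i for a suitable level
-omega(2 eps) <= c_i <= 0 makes the mean zero, and for 4 eps <= r(x_i, x_j) these
truncations are glued by functions c_i - omega((r(x_i, .) - eps)^+) into one function g
with modulus omega and g(t0) = m. Embedding the real line isometrically in X along an
invertible convex element turns g and -g into two functions with the same information
whose values at t0 are 2 m apart. *)

Set Implicit Arguments. Unset Strict Implicit. Unset Printing Implicit Defensive.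

(** * Euclidean geometry *)

Section EuclideanGeometry.
Variables (R : realType) (d : nat).
Implicit Types (s t u v p q c : 'rV[R]_d).

Definition dotp s t : R := \sum_(i < d) s 0 i * t 0 i.

Lemma dotpC s t : dotp s t = dotp t s.
Proof. by apply: eq_bigr => i _; rewrite mulrC. Qed.

Lemma dotpDl s t u : dotp (s + t) u = dotp s u + dotp t u.
Proof. by rewrite /dotp -big_split; apply: eq_bigr => i _; rewrite mxE mulrDl. Qed.

Lemma dotpZl k s u : dotp (k *: s) u = k * dotp s u.
Proof. by rewrite /dotp mulr_sumr; apply: eq_bigr => i _; rewrite mxE mulrA. Qed.

Lemma dotpNl s u : dotp (- s) u = - dotp s u.
Proof. by rewrite -scaleN1r dotpZl mulN1r. Qed.

Lemma dotpDr s t u : dotp u (s + t) = dotp u s + dotp u t.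
Proof. by rewrite dotpC dotpDl !(dotpC u). Qed.

Lemma dotpZr k s u : dotp u (k *: s) = k * dotp u s.
Proof. by rewrite dotpC dotpZl (dotpC u). Qed.

Lemma dotpNr s u : dotp u (- s) = - dotp u s.
Proof. by rewrite dotpC dotpNl (dotpC u). Qed.

Definition dotpE := (dotpDl, dotpDr, dotpNl, dotpNr, dotpZl, dotpZr).

Lemma dotp_ge0 s : 0 <= dotp s s.
Proof. by apply: sumr_ge0 => i _; rewrite -expr2 sqr_ge0. Qed.

Lemma dotp_eq0 s : dotp s s = 0 -> s = 0.
Proof.
move=> /eqP; rewrite psumr_eq0 => [/allP h|i _]; last by rewrite -expr2 sqr_ge0.
apply/rowP => i; rewrite mxE; have := h i; rewrite mem_index_enum => /(_ isT).
by rewrite mulf_eq0 orbb => /eqP.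
Qed.

(** The squared norm of |t|^2 s - <s,t> t is nonnegative and equals |t|^2 times the difference of
    the two sides. *)
Lemma dotp_CauchySchwarz s t : dotp s t ^+ 2 <= dotp s s * dotp t t.
Proof.
have [t0|tN0] := eqVneq (dotp t t) 0.
  by rewrite (dotp_eq0 t0) -(scale0r (0 : 'rV[R]_d)) !dotpZr !(mul0r, mulr0) expr0n.
have tp : 0 < dotp t t by rewrite lt_neqAle eq_sym tN0 dotp_ge0.
have := dotp_ge0 (dotp t t *: s - dotp s t *: t).
rewrite !dotpE (dotpC t s).
set X := (X in 0 <= X).
have -> : X = dotp t t * (dotp s s * dotp t t - dotp s t ^+ 2) by rewrite /X; ring.
by rewrite pmulr_rge0// subr_ge0.
Qed.

Lemma euclE s t : eucl s t = Num.sqrt (dotp (s - t) (s - t)).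
Proof. by congr Num.sqrt; apply: eq_bigr => i _; rewrite !mxE expr2. Qed.

Lemma eucl_ge0 s t : 0 <= eucl s t. Proof. exact: sqrtr_ge0. Qed.

Lemma eucl_sqr s t : eucl s t ^+ 2 = dotp (s - t) (s - t).
Proof. by rewrite euclE sqr_sqrtr// dotp_ge0. Qed.

Lemma euclC s t : eucl s t = eucl t s.
Proof. by rewrite !euclE -opprB dotpNl dotpNr opprK. Qed.

Lemma euclxx s : eucl s s = 0.
Proof. by rewrite euclE subrr /dotp big1 ?sqrtr0// => i _; rewrite mxE mul0r. Qed.

Lemma eucl_le_sqr s t u v :
  (eucl s t <= eucl u v) = (dotp (s - t) (s - t) <= dotp (u - v) (u - v)).
Proof. by rewrite -!eucl_sqr ler_pXn2r// nnegrE eucl_ge0. Qed.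

Lemma eucl_gt0 s t : s != t -> 0 < eucl s t.
Proof.
move=> st; rewrite lt_neqAle eucl_ge0 andbT eq_sym.
apply: contra_neq st => st0; apply/eqP; rewrite -subr_eq0; apply/eqP/dotp_eq0.
by rewrite -eucl_sqr st0 expr0n.
Qed.

Lemma eucl_triangle t s u : eucl s u <= eucl s t + eucl t u.
Proof.
rewrite -(@ler_pXn2r _ 2)// ?nnegrE ?addr_ge0 ?eucl_ge0//.
rewrite sqrrD !eucl_sqr.
have -> : s - u = (s - t) + (t - u) by rewrite addrA subrK.
suff : dotp (s - t) (t - u) <= eucl s t * eucl t u.
  move: (s - t) (t - u) => a b; rewrite !dotpE (dotpC b a); lra.
apply: (le_trans (ler_norm _)).
rewrite -(@ler_pXn2r _ 2)// ?nnegrE ?mulr_ge0 ?eucl_ge0//.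
by rewrite real_normK ?num_real// exprMn !eucl_sqr dotp_CauchySchwarz.
Qed.

Lemma eucl_dist t s u : `|eucl t s - eucl t u| <= eucl s u.
Proof.
have h1 := eucl_triangle u t s; have h2 := eucl_triangle s t u.
by rewrite (euclC u s) in h1; rewrite ler_distl; apply/andP; split; lra.
Qed.

Lemma euclD c s t : eucl (s + c) (t + c) = eucl s t.
Proof. by rewrite !euclE opprD addrACA subrr addr0. Qed.

Lemma euclN s t : eucl (- s) (- t) = eucl s t.
Proof. by rewrite !euclE -opprD dotpNl dotpNr opprK. Qed.

Lemma eucl_coord s t i : `|s 0 i - t 0 i| <= eucl s t.
Proof.
rewrite -(@ler_pXn2r _ 2)// ?nnegrE ?eucl_ge0//.
rewrite real_normK ?num_real// eucl_sqr /dotp (bigD1 i)//= !mxE -expr2 lerDl.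
by apply: sumr_ge0 => j _; rewrite -expr2 sqr_ge0.
Qed.

(** Compares the Euclidean metric with the sup norm, which defines the topology of row vectors. The
    crude factor d, instead of its square root, is enough. *)
Lemma eucl_le_coord s t e : (forall i, `|s 0 i - t 0 i| <= e) -> 0 <= e ->
  eucl s t <= d%:R * e.
Proof.
move=> h e0; rewrite -(@ler_pXn2r _ 2)// ?nnegrE ?eucl_ge0 ?mulr_ge0//.
rewrite eucl_sqr; apply: (@le_trans _ _ (d%:R * e ^+ 2)).
  have -> : d%:R * e ^+ 2 = \sum_(i < d) e ^+ 2 by rewrite sumr_const card_ord mulr_natl.
  apply: ler_sum => i _.
  by rewrite !mxE -expr2 -real_normK ?num_real// ler_pXn2r// nnegrE.
rewrite exprMn ler_wpM2r ?sqr_ge0// -natrX ler_nat.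
by case: (d) => // k; rewrite -{1}(expn1 k.+1) leq_pexp2l.
Qed.

(** The orthogonal reflection in the hyperplane through 0 with normal u. *)
Definition reflection u s := s - (2 * dotp s u / dotp u u) *: u.

Lemma reflectionD u s t : reflection u (s + t) = reflection u s + reflection u t.
Proof. by rewrite /reflection dotpDl mulrDr mulrDl scalerDl opprD addrACA. Qed.

Lemma reflectionN u s : reflection u (- s) = - reflection u s.
Proof. by rewrite /reflection dotpNl mulrN mulNr scaleNr opprD. Qed.

Lemma reflectionK u : u != 0 -> cancel (reflection u) (reflection u).
Proof.
move=> u0 s; have uu : dotp u u != 0 by apply: contra_neq u0 => /dotp_eq0.
rewrite {1}/reflection {2}/reflection !dotpE /reflection -addrA -opprD -scalerDl.
have -> : 2 * dotp s u / dotp u u +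
    2 * (dotp s u - 2 * dotp s u / dotp u u * dotp u u) / dotp u u = 0 by field.
by rewrite scale0r subr0.
Qed.

Lemma dotp_reflection u s : u != 0 -> dotp (reflection u s) (reflection u s) = dotp s s.
Proof.
move=> u0; have uu : dotp u u != 0 by apply: contra_neq u0 => /dotp_eq0.
by rewrite /reflection !dotpE (dotpC u s); field.
Qed.

Lemma eucl_reflection u s t : u != 0 -> eucl (reflection u s) (reflection u t) = eucl s t.
Proof. by move=> u0; rewrite !euclE -reflectionN -reflectionD dotp_reflection. Qed.

(* the reflection across the bisector of p and q *)
Definition bisect p q s := reflection (q - p) (s - p) + q.

Lemma eucl_bisect p q s t : p != q -> eucl (bisect p q s) (bisect p q t) = eucl s t.
Proof. by move=> pq; rewrite /bisect euclD eucl_reflection ?euclD// subr_eq0 eq_sym. Qed.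

Lemma bisect_l p q : bisect p q p = q.
Proof.
rewrite /bisect subrr /reflection -(scale0r (0 : 'rV[R]_d)) dotpZl !(mul0r, mulr0) !scale0r.
by rewrite subr0 add0r.
Qed.

Lemma bisect_r p q : p != q -> bisect p q q = p.
Proof.
move=> pq; have uu : dotp (q - p) (q - p) != 0.
  by apply: contra_neq pq => /dotp_eq0 /eqP; rewrite subr_eq0 => /eqP.
rewrite /bisect /reflection -mulrA divff// mulr1 scaler_nat mulr2n opprD addrA subrr.
by rewrite sub0r opprB subrK.
Qed.

(** With u = q - p, a = t - p, b = s - p and k = 2<b,u>/<u,u>, the difference of the squared
    distances is (k - 1)(2<a,u> - <u,u>). Each hypothesis, that t or s is on the side of p, says
    that one factor is nonpositive. *)
Lemma eucl_bisect_far p q s t : p != q -> eucl t p <= eucl t q -> eucl s p <= eucl s q ->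
  eucl t s <= eucl t (bisect p q s).
Proof.
move=> pq; rewrite !eucl_le_sqr /bisect /reflection.
set u := q - p; set a := t - p; set b := s - p.
have -> : t - q = a - u by rewrite /a /u opprB addrA subrK.
have -> : s - q = b - u by rewrite /b /u opprB addrA subrK.
have -> : t - s = a - b by rewrite /a /b opprB addrA subrK.
set k := 2 * _ / _.
have -> : t - (b - k *: u + q) = a - b + (k - 1) *: u.
  by rewrite /a /b /u; apply/rowP => i; rewrite !mxE; ring.
have u0 : 0 < dotp u u.
  rewrite lt_neqAle eq_sym dotp_ge0 andbT; apply: contra_neq pq => /dotp_eq0 /eqP.
  by rewrite subr_eq0 => /eqP.
have : k * dotp u u = 2 * dotp b u by rewrite /k divfK// gt_eqF.
clearbody k; clearbody a b u => kE h1 h2.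
have {}h1 : 2 * dotp a u <= dotp u u.
  by move: h1; rewrite !dotpE (dotpC u a); lra.
have {}h2 : k <= 1.
  rewrite -(ler_pM2r u0) kE mul1r.
  by move: h2; rewrite !dotpE (dotpC u b); lra.
rewrite -subr_ge0.
have -> : dotp (a - b + (k - 1) *: u) (a - b + (k - 1) *: u) - dotp (a - b) (a - b) =
  (k - 1) * (2 * dotp a u - dotp u u + (k * dotp u u - 2 * dotp b u)).
  by rewrite !dotpE (dotpC u a) (dotpC u b) (dotpC b a); ring.
by rewrite kE subrr addr0 mulr_le0// subr_le0.
Qed.

End EuclideanGeometry.

(** * Borel sets *)

Section BorelSets.
Variables (R : realType) (d : nat).
Implicit Types (s t c a b : 'rV[R]_d) (D : set (Rd R d)).

Lemma nbhs_euclP s (U : set 'rV[R]_d) :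
  nbhs s U <-> exists2 e : R, 0 < e & forall y, eucl s y < e -> U y.
Proof.
split=> [/nbhs_ballP[e /= e0 sU]|[e e0 sU]].
  exists e => // y sy; apply: sU; split => // i j.
  by rewrite ord1; exact: le_lt_trans (eucl_coord _ _ _) sy.
(* Dividing by d + 1 makes the final inequality strict and also covers d = 0. *)
have d0 : 0 < d.+1%:R :> R by rewrite ltr0n.
apply/nbhs_ballP; exists (e / d.+1%:R) => /=; first by rewrite divr_gt0.
move=> y [_ sy]; apply: sU.
apply: (@le_lt_trans _ _ (d%:R * (e / d.+1%:R))).
  by apply: eucl_le_coord => [i|]; [exact/ltW/sy|rewrite divr_ge0// ltW].
by rewrite mulrCA gtr_pMr// ltr_pdivrMr// mul1r ltr_nat.
Qed.

Definition ucont D (g : Rd R d -> R) := forall e, 0 < e -> exists2 r : R, 0 < r &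
  forall s t, D s -> D t -> eucl s t < r -> `|g s - g t| < e.

Lemma open_measurable_Rd (U : set 'rV[R]_d) : open U -> measurable (U : set (Rd R d)).
Proof. by move=> oU; exact: sub_sigma_algebra. Qed.

(** A superlevel set of g in D is the trace on D of an open set U: the union of the balls centred in
    D on whose trace g exceeds the level. *)
Lemma ucont_measurable D g : ucont D g -> measurable_fun D g.
Proof.
move=> ug mD; apply: (measurability _ (RGenOInfty.measurableE R)) => //.
move=> /= _ [_ [x ->] <-].
pose U : set 'rV[R]_d := [set y | exists s, exists r, [/\ D s, 0 < r, eucl s y < r &
  forall t, D t -> eucl s t < r -> x < g t]].
have -> : D `&` g @^-1` `]x, +oo[%classic = D `&` U.
  apply/seteqP; split=> y [Dy /=]; last first.
    by move=> [s [r [Ds r0 sy h]]]; split => //=; rewrite in_itv/= andbT; exact: h.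
  rewrite in_itv/= andbT => xy; split => //; have [|r r0 h] := ug (g y - x); first by rewrite subr_gt0.
  exists y, r; split => //; first by rewrite euclxx.
  by move=> t Dt /(h _ _ Dy Dt); rewrite ltr_distl => /andP[_]; lra.
apply: measurableI => //; apply: open_measurable_Rd; rewrite openE => y [s [r [Ds r0 sy h]]].
apply/nbhs_euclP; exists (r - eucl s y); first by rewrite subr_gt0.
move=> z yz; exists s, r; split => //.
by rewrite (le_lt_trans (eucl_triangle y _ _))// -ltrBrDl.
Qed.

Lemma ucont_within D g : ucont D g -> {within (D : set 'rV[R]_d), continuous (g : 'rV[R]_d -> R)}.
Proof.
move=> ug; apply/subspace_continuousP => s Ds; apply/cvgrPdist_lt => e e0.
have [r r0 h] := ug _ e0; apply/nbhs_euclP; exists r => // y sy Dy; exact: h.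
Qed.

Lemma lip_ucont D (g : Rd R d -> R) :
  (forall s t, D s -> D t -> `|g s - g t| <= eucl s t) -> ucont D g.
Proof. by move=> h e e0; exists e => // s t Ds Dt; exact/le_lt_trans/h. Qed.

Lemma measurable_coord i : measurable_fun setT (fun y : Rd R d => y 0 i).
Proof. by apply: ucont_measurable; apply: lip_ucont => s t _ _; exact: eucl_coord. Qed.

Lemma measurable_eucl c : measurable_fun setT (fun y : Rd R d => eucl c y).
Proof. by apply: ucont_measurable; apply: lip_ucont => s t _ _; exact: eucl_dist. Qed.

Lemma measurable_cball c e : measurable (cball c e : set (Rd R d)).
Proof.
rewrite -[X in measurable X]setTI.
have := measurable_eucl c measurableT (measurable_itv `]-oo, e]).
by congr measurable; apply/seteqP; split => y [_ /=]; rewrite /cball /= in_itv/= euclC.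
Qed.

Definition box a b : set (Rd R d) := [set y | forall i, a 0 i <= y 0 i <= b 0 i].

Lemma measurable_box a b : measurable (box a b).
Proof.
have -> : box a b = \bigcap_(i in [set: 'I_d]) ((fun y : Rd R d => y 0 i) @^-1` `[a 0 i, b 0 i]%classic).
  apply/seteqP; split => y /= h i; first by move=> _ /=; rewrite in_itv/=.
  by have := h i I; rewrite /= in_itv/=.
apply: fin_bigcap_measurable => // i _.
by rewrite -[X in measurable X]setTI; exact: measurable_coord.
Qed.

Definition boxes : set (set (Rd R d)) := [set B | exists a b, B = box a b].

(** An open set is the union of the boxes with rational corners that it contains. So the boxes, on
    which [is_lebesgue] prescribes the measure, generate the Borel sets. *)
Lemma measurable_boxesE : @measurable _ (Rd R d) = <<s boxes >>.
Proof.
apply/seteqP; split; last first.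
  apply: smallest_sub; first exact: sigma_algebra_measurable.
  by move=> _ [a [b ->]]; exact: measurable_box.
apply: smallest_sub; first exact: smallest_sigma_algebra.
move=> U oU.
pose qv (a : 'rV[rat]_d) : 'rV[R]_d := map_mx ratr a.
(* Boxes not contained in U are replaced by the empty set, so that the union runs over the countable
   type of all pairs of rational corners. *)
have -> : U = \bigcup_(ab : 'rV[rat]_d * 'rV[rat]_d)
    (if `[< box (qv ab.1) (qv ab.2) `<=` U >] then box (qv ab.1) (qv ab.2) else set0).
  apply/seteqP; split => [y Uy|y [ab _]]; last by case: asboolP => // + ?; apply.
  have /nbhs_ballP[e /= e0 eU] : nbhs (y : 'rV[R]_d) U by move: oU; rewrite openE; apply.
  have /choice[a ha] : forall i : 'I_d, exists q : rat, y 0 i - e < ratr q <= y 0 i.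
    move=> i; have [|q] := @rat_in_itvoo R (y 0 i - e) (y 0 i); first by rewrite gtrBl.
    by rewrite in_itv/= => /andP[h1 h2]; exists q; rewrite h1 ltW.
  have /choice[b hb] : forall i : 'I_d, exists q : rat, y 0 i <= ratr q < y 0 i + e.
    move=> i; have [|q] := @rat_in_itvoo R (y 0 i) (y 0 i + e); first by rewrite ltrDl.
    by rewrite in_itv/= => /andP[h1 h2]; exists q; rewrite h2 ltW.
  exists (\row_i a i, \row_i b i) => //=; case: asboolP => [_|[]].
    by move=> i; rewrite !mxE; have /andP[_ ->] := ha i; have /andP[-> _] := hb i.
  move=> z hz; apply: eU; split => // i0 i; rewrite ord1 /ball /=.
  have := hz i; rewrite !mxE; have := ha i; have := hb i => /andP[h1 h2] /andP[h3 h4] /andP[h5 h6].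
  by rewrite ltr_distlC; apply/andP; split; [exact: lt_le_trans h5|exact: le_lt_trans h2].
have cnt : countable [set: 'rV[rat]_d * 'rV[rat]_d] by exact: countableP.
apply: (@countable_bigcupT_measurable _ (g_sigma_algebraType boxes) _ _ cnt) => ab.
case: asboolP => _; last exact: measurable0.
by apply: sub_sigma_algebra; exists (qv ab.1), (qv ab.2).
Qed.

Lemma measurable_fun_Rd (d' : measure_display) (Y : measurableType d') (E : set Y) (F : Y -> Rd R d) :
  (forall i, measurable_fun E (fun y => F y 0 i)) -> measurable_fun E F.
Proof.
move=> mF mE; apply: (measurability _ measurable_boxesE) => //.
move=> /= _ [_ [a [b ->]] <-].
(* The last factor [E] matters for d = 0, where the intersection over the coordinates is the whole
   space. *)
have -> : E `&` F @^-1` box a b =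
    \bigcap_(i in [set: 'I_d]) (E `&` (fun y => F y 0 i) @^-1` `[a 0 i, b 0 i]%classic) `&` E.
  apply/seteqP; split => [y [Ey /= h]|y [h Ey]].
    by split => // i _; split => //=; rewrite in_itv/=.
  by split => // i; have [_] := h i I; rewrite /= in_itv.
apply: measurableI => //; apply: fin_bigcap_measurable => // i _.
exact: mF.
Qed.

End BorelSets.

(** * Translation and reflection invariance *)

Section TranslationInvariance.
Variables (R : realType) (d : nat).
Implicit Types (m : {measure set (Rd R d) -> \bar R}) (c u : 'rV[R]_d).

Definition shift c (y : Rd R d) : Rd R d := (y : 'rV[R]_d) + c.

Lemma measurable_shift c : measurable_fun setT (shift c).
Proof.
apply: measurable_fun_Rd => i; under eq_fun do rewrite mxE.
by apply: measurable_funD => //; exact: measurable_coord.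
Qed.

Lemma measurable_opp : measurable_fun setT (fun y : Rd R d => (- (y : 'rV[R]_d) : Rd R d)).
Proof.
apply: measurable_fun_Rd => i; under eq_fun do rewrite mxE.
exact: (measurable_funN (measurable_coord i)).
Qed.

Lemma measurable_reflection u : measurable_fun setT (fun y : Rd R d => (reflection u y : Rd R d)).
Proof.
apply: measurable_fun_Rd => i; under eq_fun do rewrite !mxE.
apply: measurable_funB; first exact: measurable_coord.
apply: measurable_funM => //; apply: measurable_funM => //; apply: measurable_funM => //.
apply: measurable_sum => j; apply: measurable_funM => //; exact: measurable_coord.
Qed.

Lemma measurable_preimage (d1 d2 : measure_display) (T1 : measurableType d1)
    (T2 : measurableType d2) (F : T1 -> T2) (A : set T2) :
  measurable_fun setT F -> measurable A -> measurable (F @^-1` A).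
Proof. by move=> mF mA; rewrite -[X in measurable X]setTI; exact: mF. Qed.

Definition shift_invariant m := forall c A, measurable A -> m (shift c @^-1` A) = m A.

(** Tonelli for an indicator. Sigma-finiteness comes as a hypothesis, hence it is first packed with
    the measures into [n1] and [n2]. *)
Lemma measure_sections m1 m2 (A : set (Rd R d * Rd R d)) :
  sigma_finite setT m1 -> sigma_finite setT m2 -> measurable A ->
  (\int[m1]_x m2 (xsection A x) = \int[m2]_y m1 (ysection A y))%E.
Proof.
move=> s1 s2 mA.
pose n1 := HB.pack_for (SigmaFiniteMeasure.type (Rd R d) R) (Measure.sort m1)
  (isSFinite.Build _ _ _ _ (sfinite_measure_sigma_finite s1))
  (isSigmaFinite.Build _ _ _ _ s1).
pose n2 := HB.pack_for (SigmaFiniteMeasure.type (Rd R d) R) (Measure.sort m2)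
  (isSFinite.Build _ _ _ _ (sfinite_measure_sigma_finite s2))
  (isSigmaFinite.Build _ _ _ _ s2).
have := indic_fubini_tonelli n1 n2 mA.
by rewrite indic_fubini_tonelli_FE// indic_fubini_tonelli_GE.
Qed.

Lemma measurable_addR : measurable_fun setT
  (fun z : Rd R d * Rd R d => ((z.1 : 'rV[R]_d) + z.2 : Rd R d)).
Proof.
apply: measurable_fun_Rd => i; under eq_fun do rewrite mxE.
apply: measurable_funD.
  exact: (measurableT_comp (measurable_coord i) measurable_fst).
exact: (measurableT_comp (measurable_coord i) measurable_snd).
Qed.

Lemma measurable_subR : measurable_fun setT
  (fun z : Rd R d * Rd R d => ((z.1 : 'rV[R]_d) - z.2 : Rd R d)).
Proof.
apply: measurable_fun_Rd => i; under eq_fun do rewrite !mxE.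
apply: measurable_funB.
  exact: (measurableT_comp (measurable_coord i) measurable_fst).
exact: (measurableT_comp (measurable_coord i) measurable_snd).
Qed.

(* Computes the measures of {(x, y) | x in A, x + y in B} and of its shear
   {(x, y) | x - y in A, x in B} under the product of m1 and m2. *)
Lemma shift_invariant_exchange m1 m2 (A B : set (Rd R d)) :
  sigma_finite setT m1 -> sigma_finite setT m2 ->
  shift_invariant m1 -> shift_invariant m2 -> measurable A -> measurable B ->
  (m2 B * m1 A = m2 [set y | A (- (y : 'rV[R]_d))%R] * m1 B)%E.
Proof.
move=> s1 s2 i1 i2 mA mB.
pose S1 : set (Rd R d * Rd R d) := (fst @^-1` A) `&` ((fun z => z.1 + z.2 : 'rV[R]_d) @^-1` B).
pose S2 : set (Rd R d * Rd R d) := ((fun z => z.1 - z.2 : 'rV[R]_d) @^-1` A) `&` (fst @^-1` B).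
have mS1 : measurable S1.
  apply: measurableI; first exact: (measurable_preimage measurable_fst).
  exact: (measurable_preimage measurable_addR).
have mS2 : measurable S2.
  apply: measurableI; last exact: (measurable_preimage measurable_fst).
  exact: (measurable_preimage measurable_subR).
transitivity (\int[m1]_x m2 (xsection S1 x))%E.
  rewrite -integral_cst// integral_mkcond; apply: eq_integral => x _.
  rewrite patchE /=; case: ifPn => xA.
    rewrite -(i2 x)//; congr (m2 _); apply/seteqP; split => y.
      by move=> By; apply/xsectionP; split => //=; [exact: set_mem|rewrite /= addrC].
    by move=> /xsectionP[_ /=]; rewrite addrC.
  rewrite (_ : xsection _ _ = set0) ?measure0//; apply/seteqP; split => y // /xsectionP[/= Ax].
  by move: xA; rewrite mem_set.
transitivity (\int[m1]_x m2 (xsection S2 x))%E; last first.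
  rewrite -integral_cst// integral_mkcond; apply: eq_integral => x _.
  rewrite patchE /=; case: ifPn => xB.
    rewrite -[RHS](i2 (- (x : 'rV[R]_d))); last exact: (measurable_preimage measurable_opp).
    congr (m2 _); apply/seteqP; split => y.
      by move=> /xsectionP[/= + _]; rewrite /shift /= opprD opprK addrC.
    rewrite /shift /= opprD opprK addrC => h; apply/xsectionP; split => //.
    exact: set_mem.
  rewrite (_ : xsection _ _ = set0) ?measure0//; apply/seteqP; split => y // /xsectionP[_ /= Ax].
  by move: xB; rewrite mem_set.
(* For fixed y, the section of [S1] is the preimage of the section of [S2] under the shift by y. *)
rewrite !measure_sections//; apply: eq_integral => y _.
rewrite -[RHS](i1 y); last exact: measurable_ysection.
congr (m1 _); apply/seteqP; split => x.
  by move=> /ysectionP[/= Ax Bx]; apply/ysectionP; rewrite /S2 /shift /= addrK.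
by move=> /ysectionP; rewrite /S2 /shift /= addrK => -[Ax Bx]; apply/ysectionP.
Qed.

End TranslationInvariance.

(** * Uniqueness and invariance of the Lebesgue measure *)

Section LebesgueMeasure.
Variables (R : realType) (d : nat) (mu : {measure set (Rd R d) -> \bar R}).
Hypothesis hmu : is_lebesgue mu.
Implicit Types (a b c p q t u : 'rV[R]_d).

Lemma box_empty a b : ~ (forall i, a 0 i <= b 0 i) -> box a b = set0.
Proof.
move=> ab; apply/seteqP; split => y //= h; apply: ab => i.
by have /andP[] := h i; exact: le_trans.
Qed.

Lemma lebesgue_box_lty a b : (mu (box a b) < +oo)%E.
Proof.
have [ab|/box_empty->] := pselect (forall i, a 0 i <= b 0 i); last by rewrite measure0.
by rewrite hmu// ltry.
Qed.

Definition cube (k : nat) : set (Rd R d) := box (const_mx (- k%:R)) (const_mx k%:R).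

Lemma bigcup_cube : \bigcup_k cube k = setT.
Proof.
apply/seteqP; split => // y _.
pose N := \max_(i < d) (Num.truncn `|y 0 i|%R).+1.
exists N => // i; rewrite !mxE -ler_norml.
apply: (@le_trans _ _ (Num.truncn `|y 0 i|).+1%:R); first exact/ltW/truncnS_gt.
by rewrite ler_nat; exact: (leq_bigmax i).
Qed.

(** The boxes are a generator stable under intersection, and the cubes of finite measure exhaust the
    space. The hypothesis speaks of boxes with ordered corners only; all others are empty. *)
Lemma lebesgue_unique (m : {measure set (Rd R d) -> \bar R}) A :
  (forall a b, (forall i, a 0 i <= b 0 i) -> mu (box a b) = m (box a b)) ->
  measurable A -> mu A = m A.
Proof.
move=> h; apply: (measure_unique _ cube (@measurable_boxesE R d)).
- move=> _ _ [a1 [b1 ->]] [a2 [b2 ->]].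
  exists (\row_i Num.max (a1 0 i) (a2 0 i)), (\row_i Num.min (b1 0 i) (b2 0 i)).
  apply/seteqP; split => [y [h1 h2] i|y h12].
    by rewrite !mxE ge_max le_min; have /andP[-> ->] := h1 i; have /andP[-> ->] := h2 i.
  by split => i; have := h12 i; rewrite !mxE ge_max le_min =>
    /andP[/andP[? ?] /andP[? ?]]; apply/andP.
- by move=> k; exists (const_mx (- k%:R)), (const_mx k%:R).
- exact: bigcup_cube.
- move=> _ [a [b ->]].
  have [ab|/box_empty->] := pselect (forall i, a 0 i <= b 0 i); first exact: h.
  by rewrite !measure0.
- by move=> k; exact: lebesgue_box_lty.
Qed.

Lemma lebesgue_sigma_finite : sigma_finite setT mu.
Proof.
exists cube; first by rewrite bigcup_cube.
by move=> i; split; [exact: measurable_box|exact: lebesgue_box_lty].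
Qed.

Definition pushm (F : Rd R d -> Rd R d) (mF : measurable_fun setT F) :
    {measure set (Rd R d) -> \bar R} :=
  measure_function_pushforward__canonical__measure_function_Measure mu mF.

Lemma lebesgue_shift_invariant : shift_invariant mu.
Proof.
move=> c A mA; apply/esym.
apply: (@lebesgue_unique (pushm (measurable_shift c))) => // a b ab.
rewrite hmu// /pushm /= /pushforward.
have -> : shift c @^-1` box a b = box (a - c) (b - c).
  by apply/seteqP; split => y h i; have := h i; rewrite /shift !mxE lerBlDr lerBrDr.
rewrite hmu; last by move=> i; rewrite !mxE lerD2r ab.
by congr EFin; apply: eq_bigr => i _; rewrite !mxE; ring.
Qed.

Lemma cball_lty c (e : R) : (mu (cball c e) < +oo)%E.
Proof.
apply: (@le_lt_trans _ _ (mu (box (c - const_mx e) (c + const_mx e)))); last exact: lebesgue_box_lty.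
apply: le_measure; rewrite ?inE; [exact: measurable_cball|exact: measurable_box|].
by move=> y cy i; rewrite !mxE -ler_distl; exact: le_trans (eucl_coord _ _ _) cy.
Qed.

Lemma cball_gt0 c (e : R) : 0 < e -> (0 < mu (cball c e))%E.
Proof.
move=> e0; have d0 : 0 < d.+1%:R :> R by rewrite ltr0n.
(* The box with lowest corner c and side r lies in the ball and has positive volume. *)
pose r : R := e / d.+1%:R; have r0 : 0 < r by rewrite divr_gt0.
apply: (@lt_le_trans _ _ (mu (box c (c + const_mx r)))).
  rewrite hmu; last by move=> i; rewrite !mxE lerDl ltW.
  by rewrite lte_fin prodr_gt0// => i _; rewrite !mxE addrAC subrr add0r.
apply: le_measure; rewrite ?inE; [exact: measurable_box|exact: measurable_cball|].
move=> y cy; rewrite /cball /=; apply: (@le_trans _ _ (d%:R * r)).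
  apply: eucl_le_coord; last exact: ltW.
  move=> i; have := cy i; rewrite !mxE => /andP[h1 h2].
  by rewrite ger0_norm ?subr_ge0// lerBlDl.
by rewrite /r mulrCA ger_pMr// ler_pdivrMr// mul1r ler_nat.
Qed.

Lemma cball_fin c (e : R) : mu (cball c e) \is a fin_num.
Proof. by rewrite ge0_fin_numE//; exact: cball_lty. Qed.

Lemma fine_cball_gt0 c (e : R) : 0 < e -> 0 < fine (mu (cball c e)).
Proof. by move=> e0; rewrite fine_gt0// cball_gt0// cball_lty. Qed.

(** The image measure [nu] is again shift invariant because reflection is additive. Exchanging it
    with [mu], with the unit ball [B] as the auxiliary set, gives nu(A) mu(B) = nu(-B) mu(A). The
    ball is symmetric under negation and reflection, so nu(-B) = mu(B), and this positive finite
    factor cancels. *)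
Lemma lebesgue_reflection u A : u != 0 -> measurable A ->
  mu ((fun y : Rd R d => reflection u y : Rd R d) @^-1` A) = mu A.
Proof.
move=> u0 mA; pose nu := pushm (measurable_reflection u).
have inu : shift_invariant nu.
  move=> c B mB; rewrite /nu /pushm /= /pushforward.
  rewrite -[RHS](lebesgue_shift_invariant (reflection u c)); last first.
    exact: (measurable_preimage (measurable_reflection u)).
  by congr (mu _); apply/seteqP; split => y; rewrite /shift /= reflectionD reflectionK.
have snu : sigma_finite setT nu.
  exists (fun k => (fun y : Rd R d => reflection u y : Rd R d) @^-1` cube k).
    by rewrite -preimage_bigcup bigcup_cube preimage_setT.
  move=> k; split; first exact: (measurable_preimage (measurable_reflection u) (measurable_box _ _)).
  rewrite /nu /pushm /= /pushforward.
  have -> : (fun y : Rd R d => reflection u y : Rd R d) @^-1` ((fun y : Rd R d => reflection u y : Rd R d) @^-1` cube k) = cube k.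
    by apply/seteqP; split => y /=; rewrite reflectionK.
  exact: lebesgue_box_lty.
pose B : set (Rd R d) := cball 0 1.
have r0 : reflection u 0 = 0.
  have := reflectionD u u (- u); rewrite reflectionN !subrr; exact.
have mB : measurable B by exact: measurable_cball.
have := shift_invariant_exchange lebesgue_sigma_finite snu lebesgue_shift_invariant inu mB mA.
have -> : nu [set y | B (- (y : 'rV[R]_d))] = mu B.
  have eE (y : 'rV[R]_d) : eucl (- reflection u y) 0 = eucl y 0.
    by rewrite -[X in eucl _ X]oppr0 euclN -[X in eucl _ X]r0 eucl_reflection.
  by congr (mu _); apply/seteqP; split => y; rewrite /B /cball /= eE.
have fB : 0 < fine (mu B) by exact: fine_cball_gt0.
rewrite (muleC (mu B)) -(fineK (cball_fin 0 1)) -/B.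
move=> /(congr1 (fun z => z * (fine (mu B))^-1%:E)%E).
by rewrite -!muleA -EFinM mulfV ?gt_eqF// !mule1.
Qed.

Lemma measurable_bisect p q : measurable_fun setT (fun y : Rd R d => bisect p q y : Rd R d).
Proof.
exact: (measurableT_comp (measurable_shift q)
  (measurableT_comp (measurable_reflection (q - p)) (measurable_shift (- p)))).
Qed.

Lemma lebesgue_bisect p q A : p != q -> measurable A ->
  mu ((fun y : Rd R d => bisect p q y : Rd R d) @^-1` A) = mu A.
Proof.
move=> pq mA; have u0 : q - p != 0 by rewrite subr_eq0 eq_sym.
have m1 := measurable_preimage (measurable_shift q) mA.
have m2 := measurable_preimage (measurable_reflection (q - p)) m1.
by rewrite -[RHS](lebesgue_shift_invariant q)// -[RHS](lebesgue_reflection u0)//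
  -[RHS](lebesgue_shift_invariant (- p)).
Qed.

(* The common part of the two balls cancels; the reflection in the bisector of p and q
   maps the rest of one ball onto the rest of the other and moves it away from t. *)
Lemma ge0_integral_cball_le (w : R -> R) p q t (e : R) :
  (forall x, 0 <= x -> 0 <= w x) ->
  (forall x y, 0 <= x -> x <= y -> w x <= w y) ->
  measurable_fun setT (fun s : Rd R d => w (eucl t s)) ->
  eucl t p <= eucl t q ->
  (\int[mu]_(s in cball p e) (w (eucl t s))%:E <= \int[mu]_(s in cball q e) (w (eucl t s))%:E)%E.
Proof.
move=> w0 wm mw tpq; have [->//|pq] := eqVneq p q.
pose f := fun s : Rd R d => (w (eucl t s))%:E.
have f0 s : (0 <= f s)%E by rewrite lee_fin w0// eucl_ge0.
have mf D : measurable_fun D f.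
  by apply/measurable_EFinP; apply: measurable_funS mw.
have mB c : measurable (cball c e : set (Rd R d)) by exact: measurable_cball.
have split1 c c' : (\int[mu]_(s in cball c e) f s =
    \int[mu]_(s in cball c e `&` cball c' e) f s + \int[mu]_(s in cball c e `\` cball c' e) f s)%E.
  rewrite -ge0_integral_setU//; first by rewrite setUIDK.
  - exact: measurableI.
  - exact: measurableD.
  - by rewrite disj_set2E setDE setIACA setICr setI0.
rewrite (split1 p q) (split1 q p) setIC leeD2l//.
pose sg := fun y : Rd R d => bisect p q y : Rd R d.
have pre : sg @^-1` (cball q e `\` cball p e) = cball p e `\` cball q e.
  have e1 (y : 'rV[R]_d) : eucl (bisect p q y) q = eucl y p.
    by rewrite -[X in eucl _ X](bisect_l p q) eucl_bisect.
  have e2 (y : 'rV[R]_d) : eucl (bisect p q y) p = eucl y q.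
    by rewrite -[X in eucl _ X](bisect_r pq) eucl_bisect.
  by apply/seteqP; split => y; rewrite /cball /sg /= e1 e2.
have mD : measurable (cball q e `\` cball p e : set (Rd R d)) by exact: measurableD.
apply: (@le_trans _ _ (\int[mu]_(s in cball p e `\` cball q e) (f \o sg) s)%E).
  apply: ge0_le_integral => //.
  - exact: measurableD.
  - apply: (@measurable_funS _ _ _ _ setT) => //.
    by apply: measurableT_comp; [exact: mf|exact: measurable_bisect].
  (* A point within e of p but not of q is on the side of p of the bisector. *)
  - move=> s [h1 h2]; rewrite lee_fin wm ?eucl_ge0// eucl_bisect_far//.
    by move/negP: h2; rewrite -ltNge => /ltW; exact: le_trans.
rewrite -pre -ge0_integral_pushforward//; last exact: measurable_bisect.
rewrite le_eqVlt; apply/orP; left; apply/eqP.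
apply: (@eq_measure_integral _ _ _ _ mu (pushm (measurable_bisect p q))) => A mA _.
exact: (lebesgue_bisect pq mA).
Qed.

End LebesgueMeasure.

(** * L-spaces and their integral *)

Lemma ladd0l (R : realType) (X : LSpace R) : left_id (lzero X) (ladd X).
Proof. by move=> x; rewrite ladd_comm ladd_zero. Qed.

(** Makes the big operator lemmas (splitting, exchange of sums) apply to the sums in [sd_eval] and
    [sd_int]. *)
HB.instance Definition _ (R : realType) (X : LSpace R) :=
  Monoid.isComLaw.Build X (lzero X) (ladd X) (@ladd_assoc R X) (@ladd_comm R X) (@ladd0l R X).

Section LSpaceTheory.
Variables (R : realType) (X : LSpace R).
Implicit Types x y z : X.

Lemma hXxx x : hX X x x = 0. Proof. exact/hX_eq0. Qed.

Lemma hX_ge0 x y : 0 <= hX X x y.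
Proof. by have := hX_tri x y x; rewrite hXxx (hX_sym y) -mulr2n pmulrn_lge0. Qed.

Lemma hX_dist z x y : `|hX X x z - hX X y z| <= hX X x y.
Proof.
have h1 := hX_tri x y z; have h2 := hX_tri y x z; rewrite (hX_sym y x) in h2.
by rewrite ler_distl; apply/andP; split; lra.
Qed.

Lemma lsmul_lzero (a : R) : lsmul X a (lzero X) = lzero X.
Proof. by rewrite -{1}(lsmul_zero (lzero X)) lsmul_mul mulr0 lsmul_zero. Qed.

Lemma hX_add2 x y z t : hX X (ladd X x y) (ladd X z t) <= hX X x z + hX X y t.
Proof.
apply: (le_trans (hX_tri _ (ladd X z y) _)); apply: lerD; first exact: hX_add.
by rewrite (ladd_comm z y) (ladd_comm z t); exact: hX_add.
Qed.

Lemma hX_sum (I : Type) (r : seq I) (F G : I -> X) :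
  hX X (\big[ladd X/lzero X]_(i <- r) F i) (\big[ladd X/lzero X]_(i <- r) G i)
    <= \sum_(i <- r) hX X (F i) (G i).
Proof.
elim: r => [|i r ih]; first by rewrite !big_nil hXxx.
by rewrite !big_cons; apply: (le_trans (hX_add2 _ _ _ _)); rewrite lerD2l.
Qed.

(** This is where convexity of values enters the integral: the measure of a cell may be distributed
    over the pieces of a refinement. *)
Lemma convex_lsmul_sum x (I : Type) (r : seq I) (a : I -> R) :
  is_convex_elt x -> (forall i, 0 <= a i) ->
  lsmul X (\sum_(i <- r) a i) x = \big[ladd X/lzero X]_(i <- r) lsmul X (a i) x.
Proof.
move=> cx a0; elim: r => [|i r ih]; first by rewrite !big_nil lsmul_zero.
by rewrite !big_cons cx// ?ih// sumr_ge0.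
Qed.

Variable P : X -> X.
Hypothesis hP : convexifying P.

Lemma convexifying_convex x : is_convex_elt (P x).
Proof. by case: hP => + _; exact. Qed.

(** By surjectivity a convex element is a value of [P], and idempotence fixes the values of [P]. *)
Lemma convexifying_id x : is_convex_elt x -> P x = x.
Proof.
by case: hP => _ [h1 [_ [h2 _]]] /h1[y <-]; rewrite h2.
Qed.

Lemma convexifying_le x y : hX X (P x) (P y) <= hX X x y.
Proof. by case: hP => _ [_ [h _]]; exact: h. Qed.

Lemma convexifying0 : P (lzero X) = lzero X.
Proof. by apply: convexifying_id => a b _ _; rewrite !lsmul_lzero ladd_zero. Qed.

End LSpaceTheory.

(** * Finite Borel partitions *)

Section Partitions.
Variables (R : realType) (d : nat) (mu : {measure set (Rd R d) -> \bar R}).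

Lemma bounded_integrable (D : set (Rd R d)) (g : Rd R d -> R) (C : R) :
  measurable D -> (mu D < +oo)%E -> measurable_fun D g ->
  (forall t, D t -> `|g t| <= C) -> mu.-integrable D (EFin \o g).
Proof.
move=> mD Doo mg gC; apply: measurable_bounded_integrable => //.
exists C; split; first exact: num_real.
by move=> y Cy t Dt /=; apply: (le_trans (gC _ Dt)); exact: ltW.
Qed.

Variables (I : finType) (A : I -> set (Rd R d)) (T : set (Rd R d)).
Hypothesis mA : forall i, measurable (A i).
Hypothesis AT : forall i, A i `<=` T.
Hypothesis dA : forall i j, i != j -> A i `&` A j = set0.
Hypothesis TA : forall t, T t -> exists i, A i t.

Lemma partition_bigcup : T = \bigcup_(i in [set: I]) A i.
Proof.
apply/seteqP; split => [t /TA[i Ait]|t [i _]]; last exact: AT.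
by exists i.
Qed.

Lemma partition_measurable_fun (phi : Rd R d -> R) :
  (forall i, measurable_fun (A i) phi) -> measurable_fun T phi.
Proof.
move=> mphi mT Y mY; rewrite partition_bigcup setI_bigcupl.
by apply: fin_bigcup_measurable => // i _; exact: mphi.
Qed.

(** Serves three times: to split the measure of a cell along a second partition, to integrate the
    distance of two simple functions over pairs of cells, and to identify scalar simple integrals
    with Lebesgue integrals. *)
Lemma partition_Rintegral (phi : Rd R d -> R) (c : I -> R) : (mu T < +oo)%E ->
  (forall i t, A i t -> phi t = c i) ->
  \int[mu]_(t in T) phi t = \sum_i c i * fine (mu (A i)).
Proof.
move=> Too hphi.
have mT : measurable T by rewrite partition_bigcup; exact: fin_bigcup_measurable.
have fA i : mu (A i) \is a fin_num.
  rewrite ge0_fin_numE//; apply: le_lt_trans Too.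
  by apply: le_measure; rewrite ?inE.
have ii i : mu.-integrable T (EFin \o (fun t => c i * \1_(A i) t)).
  apply: (@bounded_integrable _ _ `|c i|) => //.
    by apply: measurable_funM => //; exact: measurable_indic.
  move=> t _; rewrite normrM indicE; case: (t \in A i); rewrite ?normr1 ?mulr1//.
  by rewrite normr0 mulr0.
have -> : \int[mu]_(t in T) phi t = fine (\int[mu]_(t in T) \sum_(i : I) (c i * \1_(A i) t)%:E)%E.
  congr fine; apply: eq_integral => t; rewrite inE => /TA[i Ait].
  rewrite (hphi i)// sumEFin (bigD1 i)//= indicE mem_set// mulr1 big1 ?addr0// => j ji.
  rewrite indicE memNset ?mulr0// => Ajt.
  by have : (A j `&` A i) t by []; rewrite dA.
rewrite (integral_sum mT ii).
rewrite -sum_fine => [|i _]; last exact: integrable_fin_num.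
apply: eq_bigr => i _.
have := @RintegralZl _ _ _ mu T (fun t => \1_(A i) t : R) (c i) mT.
rewrite /Rintegral => ->; last first.
  apply: (@bounded_integrable _ _ 1) => //; first exact: measurable_indic.
  by move=> t _; rewrite indicE; case: (t \in A i); rewrite ?normr1 ?normr0.
by rewrite integral_indic// setIidl.
Qed.

End Partitions.

(** * Simple functions and the integral of bounded measurable functions *)

Section LSpaceIntegral.
Variables (R : realType) (X : LSpace R) (P : X -> X) (d : nat).
Variables (mu : {measure set (Rd R d) -> \bar R}) (T : set (Rd R d)).
Hypothesis hP : convexifying P.
Hypothesis mT : measurable T.
Hypothesis Too : (mu T < +oo)%E.
Implicit Types (s : sdecomp X d) (f : Rd R d -> X).

Lemma sd_evalE s i t : sd_ok T s -> (i < sd_k s)%N -> sd_A s i t -> sd_eval s t = sd_v s i.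
Proof.
move=> [_ [dj _]] ik At; rewrite /sd_eval (bigD1 (Ordinal ik))//=.
rewrite asboolT// big1 ?ladd_zero// => j ji; rewrite asboolF// => Ajt.
have : (sd_A s j `&` sd_A s i) t by [].
by rewrite dj// => ej; move: ji; rewrite -val_eqE /= ej eqxx.
Qed.

Lemma sd_cover s t : sd_ok T s -> T t -> exists i : 'I_(sd_k s), sd_A s i t.
Proof. by move=> [_ [_ h]] /h[i /= ik Ait]; exists (Ordinal ik). Qed.

Lemma sd_eval_bounded s (x0 : X) : exists C, forall t, T t -> sd_ok T s -> hX X (sd_eval s t) x0 <= C.
Proof.
exists (\sum_(i < sd_k s) hX X (sd_v s i) x0) => t Tt ok.
have [i At] := sd_cover ok Tt; rewrite (sd_evalE ok _ At)//.
by rewrite (bigD1 i)//= lerDl sumr_ge0// => j _; exact: hX_ge0.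
Qed.

Lemma fin_sub (A : set (Rd R d)) : measurable A -> A `<=` T -> (mu A < +oo)%E.
Proof. by move=> mA AT; apply: le_lt_trans Too; apply: le_measure; rewrite ?inE. Qed.

Lemma sd_int_refine s s' : sd_ok T s -> sd_ok T s' -> sd_int P mu s =
  \big[ladd X/lzero X]_(i < sd_k s) \big[ladd X/lzero X]_(j < sd_k s')
    lsmul X (fine (mu (sd_A s i `&` sd_A s' j))) (P (sd_v s i)).
Proof.
move=> ok ok'; apply: eq_bigr => i _.
rewrite -convex_lsmul_sum; first last.
- by move=> j; rewrite fine_ge0.
- exact: convexifying_convex.
congr (lsmul X _ _); have [mA AT] := ok.1 i (ltn_ord i).
transitivity (\int[mu]_(t in sd_A s i) (1 : R)).
  by rewrite Rintegral_cst ?mul1r.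
rewrite (@partition_Rintegral R d mu _ (fun j : 'I_(sd_k s') => sd_A s i `&` sd_A s' j) _ _ _ _ _ _ (fun=> 1))//.
- by apply: eq_bigr => j _; rewrite mul1r.
- by move=> j; apply: measurableI => //; have [] := ok'.1 j (ltn_ord j).
- move=> j j' jj'; rewrite setIACA ok'.2.1 ?setI0//.
  by move=> /ord_inj ejj; rewrite ejj eqxx in jj'.
- by move=> t At; have [j Aj] := sd_cover ok' (AT _ At); exists j.
- exact: fin_sub.
Qed.

(** On the common refinement both integrals are sums with the same weights, so they are compared
    term by term, [P] being nonexpansive. *)
Lemma sd_int_le s s' : sd_ok T s -> sd_ok T s' ->
  hX X (sd_int P mu s) (sd_int P mu s') <= \int[mu]_(t in T) hX X (sd_eval s t) (sd_eval s' t).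
Proof.
move=> ok ok'; rewrite (sd_int_refine ok ok') (sd_int_refine ok' ok).
under [X in hX _ _ X]eq_bigr do under eq_bigr do rewrite setIC.
rewrite [X in hX _ _ X]exchange_big /= !pair_big /=.
apply: (le_trans (hX_sum _ _ _)).
rewrite (@partition_Rintegral R d mu _
  (fun ij : 'I_(sd_k s) * 'I_(sd_k s') => sd_A s ij.1 `&` sd_A s' ij.2) _ _ _ _ _ _
  (fun ij => hX X (sd_v s ij.1) (sd_v s' ij.2)))//.
- apply: ler_sum => ij _; rewrite hX_smul ger0_norm ?fine_ge0// mulrC.
  by rewrite ler_wpM2r ?fine_ge0//; exact: convexifying_le.
- move=> [i j] /=; apply: measurableI; first by have [] := ok.1 i (ltn_ord i).
  by have [] := ok'.1 j (ltn_ord j).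
- by move=> [i j] /= t [Ai _]; have [_] := ok.1 i (ltn_ord i); exact.
- move=> [i j] [i' j'] /=; rewrite xpair_eqE negb_and setIACA => /orP[ii'|jj'].
    rewrite ok.2.1 ?set0I// => /ord_inj e; by rewrite e eqxx in ii'.
  rewrite ok'.2.1 ?setI0// => /ord_inj e; by rewrite e eqxx in jj'.
- by move=> t Tt; have [i Ai] := sd_cover ok Tt; have [j Aj] := sd_cover ok' Tt; exists (i, j).
- by move=> [i j] t /= [Ai Aj]; rewrite (sd_evalE ok _ Ai) ?(sd_evalE ok' _ Aj).
Qed.

(** The L1 distance on T from a simple function to f. It controls every estimate for the integral
    below. *)
Definition sd_err s f := \int[mu]_(t in T) hX X (sd_eval s t) (f t).

Lemma sd_err_measurable s f : sd_ok T s -> (forall x, measurable_fun T (fun t => hX X (f t) x)) ->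
  measurable_fun T (fun t => hX X (sd_eval s t) (f t)).
Proof.
move=> ok mf; apply: (@partition_measurable_fun R d _ (fun i : 'I_(sd_k s) => sd_A s i)).
- by move=> i; have [] := ok.1 i (ltn_ord i).
- by move=> i; have [] := ok.1 i (ltn_ord i).
- by move=> t Tt; have [i Ai] := sd_cover ok Tt; exists i.
- move=> i; have [mA AT] := ok.1 i (ltn_ord i).
  have /(_ (sd_v s i)) := mf => /(measurable_funS mT AT).
  by apply: eq_measurable_fun => t; rewrite inE => At; rewrite (sd_evalE ok _ At)// hX_sym.
Qed.

Lemma sd_err_integrable s f : sd_ok T s -> in_B T f ->
  mu.-integrable T (EFin \o (fun t => hX X (sd_eval s t) (f t))).
Proof.
move=> ok [[x0 [C fC]] mf]; have [C' sC] := sd_eval_bounded s x0.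
apply: (@bounded_integrable _ _ _ _ _ (C' + C)) => //; first exact: sd_err_measurable.
move=> t Tt; rewrite ger0_norm ?hX_ge0//; apply: (le_trans (hX_tri _ x0 _)).
by rewrite lerD ?sC// hX_sym fC.
Qed.

Lemma sd_in_B s : sd_ok T s -> in_B T (sd_eval s).
Proof.
move=> ok; split.
  have [C sC] := sd_eval_bounded s (lzero X).
  by exists (lzero X), C => t Tt; exact: sC.
move=> x; apply: (@sd_err_measurable s (fun=> x)) => // y.
Qed.

Lemma sd_int_tri s s' f : sd_ok T s -> sd_ok T s' -> in_B T f ->
  hX X (sd_int P mu s) (sd_int P mu s') <= sd_err s f + sd_err s' f.
Proof.
move=> ok ok' fB; apply: (le_trans (sd_int_le ok ok')).
have i1 := sd_err_integrable ok fB; have i2 := sd_err_integrable ok' fB.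
rewrite /sd_err -RintegralD//; apply: le_Rintegral => //.
- exact: sd_err_integrable (sd_in_B ok').
- exact: (integrableD mT i1 i2).
- by move=> t _; rewrite (hX_sym (sd_eval s' t)); exact: hX_tri.
Qed.

(** Dominated convergence. The dominating constant adds the radius C of the approximations about
    [x0], the radius C1 of f about [x1], and the distance of the two centres. *)
Lemma sd_err_cvg f sq : approx_seq mu T f sq -> in_B T f ->
  (fun m => sd_err (sq m) f) @ \oo --> 0.
Proof.
move=> [ok [[x0 [C sC]] [N [mN [N0 cv]]]]] fB; have [[x1 [C1 fC]] mf] := fB.
have [] := @dominated_convergence _ _ _ mu T mT
  (fun m t => (hX X (sd_eval (sq m) t) (f t))%:E) (cst 0%E) (cst (C + hX X x0 x1 + C1)%:E).
- by move=> m; apply/measurable_EFinP; exact: sd_err_measurable.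
- exact: measurable_cst.
- exists N; split => // t /=; apply: contra_notP => Nt Tt.
  by apply: cvg_EFin; [exact: nearW|exact: cv].
- exact: (@bounded_integrable _ _ _ _ (cst (C + hX X x0 x1 + C1)) `|C + hX X x0 x1 + C1|).
- apply: aeW => t m Tt /=; rewrite lee_fin ger0_norm ?hX_ge0//.
  apply: (le_trans (hX_tri _ x1 _)); apply: lerD; last by rewrite hX_sym fC.
  by apply: (le_trans (hX_tri _ x0 _)); rewrite lerD2r sC.
move=> _ _; rewrite integral0 => h.
by apply: (fine_cvg h).
Qed.


Lemma measurable_le_set (g h : Rd R d -> R) : measurable_fun T g -> measurable_fun T h ->
  measurable (T `&` [set t | g t <= h t]).
Proof.
move=> mg mh.
have : measurable (T `&` (fun t => g t <= h t) @^-1` [set true]) by exact: measurable_fun_ler.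
by congr measurable; apply/seteqP; split => t [].
Qed.

Lemma measurable_lt_set (g h : Rd R d -> R) : measurable_fun T g -> measurable_fun T h ->
  measurable (T `&` [set t | g t < h t]).
Proof.
move=> mg mh.
have : measurable (T `&` (fun t => g t < h t) @^-1` [set true]) by exact: measurable_fun_ltr.
by congr measurable; apply/seteqP; split => t [].
Qed.

(* The m-th approximation takes at t the first of the points D 0, ..., D m of a dense
   sequence that is closest to f t. *)
Lemma approx_seq_exists f : in_B T f -> exists sq, approx_seq mu T f sq.
Proof.
move=> [[x0 [C fC]] mf]; have [D dD] := hX_separable X.
pose a k t := hX X (f t) (D k).
pose A m j : set (Rd R d) := T `&` [set t | (forall i, (i <= m)%N -> a j t <= a i t) /\
  (forall i, (i < j)%N -> a j t < a i t)].
pose sq m := SDecomp m.+1 D (A m).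
have mA m j : measurable (A m j).
  have -> : A m j = (\bigcap_(i in `I_m.+1) (T `&` [set t | a j t <= a i t])) `&`
      ((\bigcap_(i in `I_j) (T `&` [set t | a j t < a i t])) `&` T).
    apply/seteqP; split => [t [Tt [h1 h2]]|t [h1 [h2 Tt]]].
      by split => [i im|]; [split => //; exact: h1|split => // i ij; split => //; exact: h2].
    by split => //; split => i ij; [have [] := h1 i ij|have [] := h2 i ij].
  apply: measurableI; first by apply: fin_bigcap_measurable => // i _; exact: (measurable_le_set (mf (D j)) (mf (D i))).
  apply: measurableI => //; apply: fin_bigcap_measurable => // i _.
  exact: (measurable_lt_set (mf (D j)) (mf (D i))).
have ok m : sd_ok T (sq m).
  split; [|split] => /=.
  - by move=> i _; split => // t [].
  - move=> i j im jm ij; apply/seteqP; split => // t [[_ [h1 h2]] [_ [h3 h4]]].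
    have [|ji|//] := ltngtP i j.
      by move=> /h4; rewrite ltNge h1.
    by have := h2 _ ji; rewrite ltNge h3.
  - move=> t Tt.
    have : exists j, [pred j | (j < m.+1)%N && [forall i : 'I_m.+1, a j t <= a i t]] j.
      have [j _ jmin] := @arg_minP _ R 'I_m.+1 ord0 xpredT (fun i => a i t) isT.
      by exists j; rewrite /= ltn_ord/=; apply/forallP => i; exact: jmin.
    move=> /ex_minnP[j /andP[jm /forallP jmin] jfst].
    exists j => //; split => //; split => [i im|i ij]; first exact: (jmin (Ordinal (im : (i < m.+1)%N))).
    rewrite ltNge; apply/negP => aij.
    suff : (j <= i)%N by rewrite leqNgt ij.
    apply: jfst; rewrite /= (ltn_trans ij jm)/=; apply/forallP => k.
    exact: le_trans aij (jmin k).
have close m t i : T t -> (i <= m)%N -> hX X (sd_eval (sq m) t) (f t) <= a i t.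
  move=> Tt im; have [j Aj] := sd_cover (ok m) Tt.
  by rewrite (sd_evalE (ok m) _ Aj)// hX_sym; have [_ [h _]] := Aj; exact: h.
exists sq; split => //; split.
  exists x0, (C + hX X x0 (D 0%N) + C) => m t Tt.
  apply: (le_trans (hX_tri _ (f t) _)); apply: lerD; last exact: fC.
  apply: (le_trans (close m t 0%N Tt isT)); rewrite /a.
  by apply: (le_trans (hX_tri _ x0 _)); rewrite lerD2r fC.
exists set0; split => //; split; first exact: measure0.
move=> t Tt _; apply/cvgrPdist_lt => e e0; have [k ke] := dD (f t) e e0.
exists k => // m /= km; rewrite sub0r normrN ger0_norm ?hX_ge0//.
by apply: (le_lt_trans (close m t k Tt km)); rewrite /a hX_sym.
Qed.

(** By [sd_int_tri] the integrals along one approximating sequence are Cauchy, and those along any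
    other one come arbitrarily close to them, since both L1 errors tend to 0. *)
Lemma approx_seq_limit f : in_B T f ->
  exists v, forall sq, approx_seq mu T f sq -> (fun m => hX X (sd_int P mu (sq m)) v) @ \oo --> 0.
Proof.
move=> fB; have [sq0 ap0] := approx_seq_exists fB.
have E0 := sd_err_cvg ap0 fB.
have [|v hv] := @hX_complete _ X (fun m => sd_int P mu (sq0 m)).
  move=> e e0; have e20 : 0 < e / 2 by rewrite divr_gt0.
  move/cvgrPdist_lt : E0 => /(_ _ e20)[N _ hN]; exists N => m k Nm Nk.
  apply: (le_lt_trans (sd_int_tri (ap0.1 m) (ap0.1 k) fB)).
  have := hN m Nm; have := hN k Nk; rewrite /= !sub0r !normrN => h1 h2.
  by have := ler_norm (sd_err (sq0 m) f); have := ler_norm (sd_err (sq0 k) f); lra.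
exists v => sq ap; have E := sd_err_cvg ap fB.
have U : (fun m => sd_err (sq m) f + sd_err (sq0 m) f + hX X (sd_int P mu (sq0 m)) v) @ \oo --> 0.
  by rewrite -(addr0 0); apply: cvgD => //; rewrite -(addr0 0); exact: cvgD.
apply: (squeeze_cvgr _ (cvg_cst 0) U); apply: nearW => m; rewrite hX_ge0/=.
apply: (le_trans (hX_tri _ (sd_int P mu (sq0 m)) _)); rewrite lerD2r.
by apply: sd_int_tri => //; [exact: ap.1|exact: ap0.1].
Qed.

(** [integral] is a choice by [epsilon], so it satisfies its specification only once some value is
    known to do so. *)
Lemma integralP f : in_B T f -> is_integral P mu T f (Defs.integral P mu T f).
Proof.
move=> fB; apply: epsilon_spec; have [v hv] := approx_seq_limit fB.
by exists v; split => //; exact: approx_seq_exists.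
Qed.

(** A single approximating sequence suffices to compute the integral, as limits in a metric space
    are unique. *)
Lemma integral_eq f sq v : in_B T f -> approx_seq mu T f sq ->
  (fun m => hX X (sd_int P mu (sq m)) v) @ \oo --> 0 -> Defs.integral P mu T f = v.
Proof.
move=> fB ap hv; have [_ /(_ _ ap) hi] := integralP fB.
apply/hX_eq0/eqP; rewrite eq_le hX_ge0 andbT.
have h : (fun m => hX X (sd_int P mu (sq m)) (Defs.integral P mu T f) + hX X (sd_int P mu (sq m)) v)
    @ \oo --> 0 by rewrite -(addr0 0); exact: cvgD.
apply: (cvgr_to_ge h); apply: nearW => m.
by apply: (le_trans (hX_tri _ (sd_int P mu (sq m)) _)); rewrite lerD2r hX_sym.
Qed.

Lemma sd_int_integral_le s f : sd_ok T s -> in_B T f ->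
  hX X (sd_int P mu s) (Defs.integral P mu T f) <= sd_err s f.
Proof.
move=> ok fB; have [sq ap] := approx_seq_exists fB; have [_ /(_ _ ap) hi] := integralP fB.
have h : (fun m => sd_err s f + (sd_err (sq m) f + hX X (sd_int P mu (sq m)) (Defs.integral P mu T f)))
    @ \oo --> sd_err s f.
  rewrite -[X in _ --> X]addr0; apply: cvgD; first exact: cvg_cst.
  by rewrite -(addr0 0); apply: cvgD => //; exact: sd_err_cvg.
apply: (cvgr_to_ge h); apply: nearW => m; rewrite addrA.
apply: (le_trans (hX_tri _ (sd_int P mu (sq m)) _)); rewrite lerD2r.
by apply: sd_int_tri => //; exact: ap.1.
Qed.

Definition indf (Q : set (Rd R d)) f t : X := if `[< Q t >] then f t else lzero X.

Lemma indf_in_B (Q : set (Rd R d)) f : measurable Q -> Q `<=` T -> in_B Q f -> in_B T (indf Q f).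
Proof.
move=> mQ QT [[x0 [C fC]] mf]; split.
  exists x0, (Num.max C (hX X (lzero X) x0)) => t Tt; rewrite /indf le_max.
  by case: asboolP => [Qt|_]; rewrite ?fC ?lexx ?orbT.
move=> x; apply: (@partition_measurable_fun R d _ (fun b : bool => if b then Q else T `\` Q)).
- by case=> //; exact: measurableD.
- by case=> // t [].
- by move=> t Tt; have [Qt|Qt] := pselect (Q t); [exists true|exists false].
case.
  by apply: eq_measurable_fun (mf x) => t; rewrite inE => Qt; rewrite /indf asboolT.
apply: (@eq_measurable_fun _ _ _ _ _ (cst (hX X (lzero X) x))) => // t; rewrite inE => -[_ Qt].
by rewrite /indf asboolF.
Qed.

(** The function equal to z on Q and to the zero element on the rest of T is simple with integral
    mu(Q) P(z). Off Q it agrees with the truncated f, so its L1 error is an integral over Q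
    alone. *)
Lemma integral_on_le (Q : set (Rd R d)) f z : measurable Q -> Q `<=` T -> in_B Q f ->
  hX X (lsmul X (fine (mu Q)) (P z)) (integral_on P mu T Q f) <= \int[mu]_(t in Q) hX X z (f t).
Proof.
move=> mQ QT fB; pose s := SDecomp 2 (fun i => if i == 0%N then z else lzero X)
  (fun i => if i == 0%N then Q else T `\` Q).
have ok : sd_ok T s.
  split; [|split] => /=.
  - by case=> [|i] _ /=; [split|split; [exact: measurableD|move=> t []]].
  - case=> [|[|i]] [|[|j]]//= _ _ _; first by rewrite setDE setICA setICr setI0.
    by rewrite setDE -setIA setICl setI0.
  - by move=> t Tt; have [Qt|Qt] := pselect (Q t); [exists 0%N|exists 1%N].
have <- : sd_int P mu s = lsmul X (fine (mu Q)) (P z).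
  rewrite /sd_int /= !big_ord_recl big_ord0 /= (convexifying0 hP).
  by rewrite !lsmul_lzero !ladd_zero.
apply: (le_trans (sd_int_integral_le ok (indf_in_B mQ QT fB))).
rewrite /sd_err (Rintegral_mkcond _ Q) [in leLHS]Rintegral_mkcond le_eqVlt; apply/orP; left; apply/eqP.
apply: eq_Rintegral => t _; rewrite !patchE.
case: ifPn => [|]; rewrite ?inE ?notin_setE => Tt; case: ifPn => [|]; rewrite ?inE ?notin_setE => Qt //.
- by rewrite (@sd_evalE s 0%N)//= /indf asboolT.
- by rewrite (@sd_evalE s 1%N)//= /indf asboolF// hXxx.
- by case: Tt; exact: QT.
Qed.

End LSpaceIntegral.

(** * Moduli of continuity and means over balls *)

Section Modulus.
Variables (R : realType) (omega : R -> R).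
Hypothesis hom : modulus omega.

Lemma modulus_ge0 a : 0 <= a -> 0 <= omega a. Proof. by case: hom => h _; exact: h. Qed.

Lemma modulus_le a b : 0 <= a -> a <= b -> omega a <= omega b.
Proof. by case: hom => _ [h _]; exact: h. Qed.

Lemma modulus0 : omega 0 = 0. Proof. by case: hom => _ [_ [_ []]]. Qed.

(** For a <= b, subadditivity gives omega(b) <= omega(a) + omega(b - a). *)
Lemma modulus_dist a b : 0 <= a -> 0 <= b -> `|omega a - omega b| <= omega `|a - b|.
Proof.
wlog ab : a b / a <= b.
  move=> h a0 b0; have [/h|/ltW/h] := leP a b; first exact.
  by rewrite distrC (distrC b); exact.
move=> a0 b0; rewrite ler0_norm ?subr_le0 ?modulus_le// ler0_norm ?subr_le0// !opprB.
rewrite lerBlDl -{1}(subrKC a b); case: hom => _ [_ [_ [_ h]]].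
by apply: h => //; rewrite subr_ge0.
Qed.

Lemma modulus_small e : 0 < e -> exists2 r : R, 0 < r & forall a, 0 <= a -> a < r -> omega a < e.
Proof.
move=> e0; case: (hom) => _ [_ [/subspace_continuousP c _]].
have /cvgrPdist_lt/(_ e e0) := c 0 (lexx _).
move=> /nbhs_ballP[r /= r0 h]; exists r => // a a0 ar.
have : `|omega 0 - omega a| < e by apply: h => //=; rewrite /ball /= sub0r normrN ger0_norm.
by rewrite modulus0 sub0r normrN ger0_norm// modulus_ge0.
Qed.

Variable d : nat.

(** The scalar case of [in_H]: up to unfolding, [in_H] for the L-space of real numbers. *)
Definition mod_cont (D : set (Rd R d)) (g : Rd R d -> R) :=
  forall s t, D s -> D t -> `|g s - g t| <= omega (eucl s t).

Lemma mod_cont_ucont D g : mod_cont D g -> ucont D g.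
Proof.
move=> h e e0; have [r r0 hr] := modulus_small e0; exists r => // s t Ds Dt st.
by apply: (le_lt_trans (h _ _ Ds Dt)); exact: hr (eucl_ge0 _ _) st.
Qed.

Lemma mod_cont_eucl D t : mod_cont D (fun s => omega (eucl t s)).
Proof.
move=> s s' _ _; apply: (le_trans (modulus_dist (eucl_ge0 _ _) (eucl_ge0 _ _))).
by apply: modulus_le => //; exact: eucl_dist.
Qed.

Lemma mod_cont_hX (X : LSpace R) D (f : Rd R d -> X) x :
  in_H D omega f -> mod_cont D (fun s => hX X (f s) x).
Proof. by move=> h s t Ds Dt; exact: le_trans (hX_dist _ _ _) (h _ _ Ds Dt). Qed.

Lemma in_H_in_B (X : LSpace R) D (f : Rd R d -> X) M : (forall s t, D s -> D t -> eucl s t <= M) ->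
  in_H D omega f -> in_B D f.
Proof.
move=> DM hf; split; last by move=> x; apply: ucont_measurable; exact: (mod_cont_ucont (mod_cont_hX x hf)).
have [[p Dp]|D0] := pselect (exists p, D p).
  exists (f p), (omega M) => t Dt; apply: (le_trans (hf _ _ Dt Dp)).
  by apply: modulus_le; [exact: eucl_ge0|exact: DM].
by exists (lzero X), 0 => t Dt; case: D0; exists t.
Qed.

Lemma cball_diam (p s t : 'rV[R]_d) e : cball p e s -> cball p e t -> eucl s t <= 2 * e.
Proof.
rewrite /cball /= => sp tp; apply: (le_trans (eucl_triangle p _ _)).
by rewrite (euclC p t) mulr_natl mulr2n lerD.
Qed.

End Modulus.

(** * Means over balls of a fixed radius *)

Section Average.
Variables (R : realType) (d : nat) (mu : {measure set (Rd R d) -> \bar R}).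
Hypothesis hmu : is_lebesgue mu.
Variable eps : R.
Hypothesis eps0 : 0 < eps.
Implicit Types (p q t : 'rV[R]_d) (g : Rd R d -> R).

Local Notation B p := (cball p eps : set (Rd R d)).

Definition avg p g : R := (fine (mu (B p)))^-1 * \int[mu]_(s in B p) g s.

Lemma cball_measure_eq p q : mu (B p) = mu (B q).
Proof.
rewrite -(lebesgue_shift_invariant hmu (p - q) (measurable_cball p eps)).
congr (mu _); apply/seteqP; split => y; rewrite /cball /shift /=;
  by rewrite -{2}(subrKC q p) euclD.
Qed.

Lemma ucont_cball_integrable p g : ucont (B p) g -> (exists C, forall s, B p s -> `|g s| <= C) ->
  mu.-integrable (B p) (EFin \o g).
Proof.
move=> ug [C gC]; apply: (@bounded_integrable _ _ _ _ _ C) => //.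
- exact: measurable_cball.
- exact: cball_lty.
- exact: ucont_measurable.
Qed.

Lemma avg_cst p (c : R) : avg p (fun=> c) = c.
Proof.
rewrite /avg Rintegral_cst; last exact: measurable_cball.
by rewrite mulrCA mulVf ?mulr1// gt_eqF// fine_cball_gt0.
Qed.

Lemma avg_le p g h : mu.-integrable (B p) (EFin \o g) -> mu.-integrable (B p) (EFin \o h) ->
  (forall s, B p s -> g s <= h s) -> avg p g <= avg p h.
Proof.
move=> ig ih gh; rewrite ler_wpM2l ?invr_ge0 ?fine_ge0//.
by apply: le_Rintegral => //; exact: measurable_cball.
Qed.

Lemma avgD p g h : mu.-integrable (B p) (EFin \o g) -> mu.-integrable (B p) (EFin \o h) ->
  avg p (fun s => g s + h s) = avg p g + avg p h.
Proof. by move=> ig ih; rewrite /avg RintegralD ?mulrDr//; exact: measurable_cball. Qed.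

Lemma cst_integrable p (c : R) : mu.-integrable (B p) (EFin \o (fun=> c)).
Proof.
apply: ucont_cball_integrable; last by exists `|c|.
by move=> e e0; exists 1 => // s t _ _ _; rewrite subrr normr0.
Qed.

Lemma avg_dist p g h (c : R) : mu.-integrable (B p) (EFin \o g) -> mu.-integrable (B p) (EFin \o h) ->
  (forall s, B p s -> `|g s - h s| <= c) -> `|avg p g - avg p h| <= c.
Proof.
move=> ig ih gh; have ic := cst_integrable p c.
have A k l : mu.-integrable (B p) (EFin \o k) -> mu.-integrable (B p) (EFin \o l) ->
    (forall s, B p s -> k s <= l s + c) -> avg p k <= avg p l + c.
  move=> ik il kl; rewrite -[in leRHS](avg_cst p c) -avgD//; apply: avg_le => //.
  exact: (integrableD (measurable_cball _ _) il ic).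
rewrite ler_distl; apply/andP; split.
  rewrite lerBlDr; apply: A => // s /gh; rewrite ler_distl => /andP[h1 _]; lra.
by apply: A => // s /gh; rewrite ler_distl => /andP[_ h1]; lra.
Qed.

Variable omega : R -> R.
Hypothesis hom : modulus omega.

Lemma mod_cont_cball_integrable p g : mod_cont omega (B p) g -> mu.-integrable (B p) (EFin \o g).
Proof.
move=> mg; apply: ucont_cball_integrable; first exact: mod_cont_ucont mg.
exists (`|g p| + omega (2 * eps)) => s Bs.
have Bp : B p p by rewrite /cball /= euclxx ltW.
have := mg _ _ Bs Bp; have := modulus_le hom (eucl_ge0 s p) (cball_diam Bs Bp) => h1 h2.
rewrite -{1}(subrK (g p) (g s)); apply: (le_trans (ler_normD _ _)).
by rewrite addrC lerD2l; exact: le_trans h1.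
Qed.

Definition avgw p t : R := avg p (fun s => omega (eucl t s)).

Lemma avgw_integrable p t : mu.-integrable (B p) (EFin \o (fun s => omega (eucl t s))).
Proof. by apply: mod_cont_cball_integrable; exact: mod_cont_eucl. Qed.

Lemma avgwE p t : ((fine (mu (B p)))^-1%:E * \int[mu]_(s in B p) (omega (eucl t s))%:E)%E =
  (avgw p t)%:E.
Proof.
rewrite /avgw /avg EFinM; congr (_ * _)%E; rewrite fineK//.
by apply: integrable_fin_num; [exact: measurable_cball|exact: avgw_integrable].
Qed.

Lemma avgw_dist p t t' : `|avgw p t - avgw p t'| <= omega (eucl t t').
Proof.
apply: avg_dist; [exact: avgw_integrable|exact: avgw_integrable|] => s _.
rewrite (euclC t s) (euclC t' s).
apply: (le_trans (modulus_dist hom (eucl_ge0 _ _) (eucl_ge0 _ _))).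
by apply: modulus_le => //; exact: eucl_dist.
Qed.

Lemma avgw_ge0 p t : 0 <= avgw p t.
Proof.
rewrite /avgw /avg mulr_ge0 ?invr_ge0 ?fine_ge0//.
by apply: integral_ge0 => s _; rewrite lee_fin (modulus_ge0 hom)// eucl_ge0.
Qed.

(** The two balls have equal measure, so the comparison of integrals obtained by reflection is a
    comparison of means. *)
Lemma avgw_le p q t : eucl t p <= eucl t q -> avgw p t <= avgw q t.
Proof.
move=> tpq; rewrite -lee_fin -!avgwE (cball_measure_eq p q) lee_pmul2l ?fine_cball_gt0//.
  apply: ge0_integral_cball_le => //; [exact: modulus_ge0|exact: modulus_le|].
  exact: (ucont_measurable (mod_cont_ucont hom (mod_cont_eucl hom (D := setT) t))).
by rewrite lte_fin invr_gt0 fine_cball_gt0.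
Qed.

Variables (n : nat) (x : 'I_n -> 'rV[R]_d).

Definition nearest t i := forall j, eucl t (x i) <= eucl t (x j).

Lemma bound_fun_nearest t i : nearest t i ->
  bound_fun mu omega (fun i => B (x i)) t = (avgw (x i) t)%:E.
Proof.
move=> ti; rewrite /bound_fun; under eq_bigr do rewrite avgwE.
apply/eqP; rewrite eq_le; apply/andP; split; first by rewrite (bigD1 i)//= ge_min lexx.
elim/big_rec: _ => [|j y _ h]; first exact: leey.
by rewrite le_min h lee_fin avgw_le.
Qed.

(** The least index is recorded because [Tpart] gives a point with several nearest centres to the
    first of them. *)
Lemma nearest_exists t : (0 < n)%N -> exists i, nearest t i /\ forall j, nearest t j -> (i <= j)%N.
Proof.
move=> n0; pose N i := [forall j, eucl t (x i) <= eucl t (x j)].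
have [i0 _ hi0] := @arg_minP _ R 'I_n (Ordinal n0) xpredT (fun i => eucl t (x i)) isT.
have Ni0 : N i0 by apply/forallP => j; exact: hi0.
have [i /forallP Ni hi] := arg_minnP (fun i : 'I_n => i : nat) Ni0.
by exists i; split => // j Nj; apply: hi; apply/forallP.
Qed.

End Average.

(** * The Voronoi method *)

Section CompactSets.
Variables (R : realType) (d : nat) (T : set 'rV[R]_d).
Hypothesis cT : compact T.

Lemma compact_sub_cball : exists M : R, T `<=` cball 0 M.
Proof.
have [[p Tp]|T0] := pselect (exists p, T p); last by exists 0 => t Tt; case: T0; exists t.
have [|c _ hc] := @compact_EVT_max _ R (fun t => eucl 0 t) T (ex_intro _ p Tp) cT.
  by apply: ucont_within; apply: lip_ucont => s t _ _; exact: eucl_dist.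
by exists (eucl 0 c) => t Tt; rewrite /cball /= euclC; apply: hc; rewrite inE.
Qed.

(** The complement is open: the distance from an outer point to a nonempty T is attained, hence
    positive. *)
Lemma compact_measurable_Rd : measurable (T : set (Rd R d)).
Proof.
have [[p Tp]|T0] := pselect (exists p, T p); last first.
  rewrite (_ : T = set0) //; apply/seteqP; split => t Tt //; by case: T0; exists t.
rewrite -(setCK (T : set (Rd R d))); apply: measurableC; apply: open_measurable_Rd.
rewrite openE => y Ty; apply/nbhs_euclP.
have [|c] := @compact_EVT_min _ R (fun t => eucl y t) T (ex_intro _ p Tp) cT.
  by apply: ucont_within; apply: lip_ucont => s t _ _; exact: eucl_dist.
rewrite inE => Tc hc; exists (eucl y c).
  by apply: eucl_gt0; apply/eqP => yc; apply: Ty; rewrite yc.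
by move=> z yz Tz; move: yz; rewrite ltNge hc// inE.
Qed.

Lemma compact_lty (mu : {measure set (Rd R d) -> \bar R}) : is_lebesgue mu -> (mu T < +oo)%E.
Proof.
move=> hmu; have [M TM] := compact_sub_cball.
apply: (le_lt_trans _ (cball_lty hmu 0 M)).
by apply: le_measure; rewrite ?inE//; [exact: compact_measurable_Rd|exact: measurable_cball].
Qed.

End CompactSets.

(** * Voronoi cells and the upper bound *)

Section VoronoiMethod.
Variables (R : realType) (X : LSpace R) (P : X -> X) (d : nat) (T : set 'rV[R]_d).
Variables (mu : {measure set (Rd R d) -> \bar R}) (omega : R -> R) (n : nat) (x : 'I_n -> 'rV[R]_d).
Hypothesis hP : convexifying P.
Hypothesis n0 : (0 < n)%N.
Hypothesis cT : compact T.
Hypothesis hmu : is_lebesgue mu.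
Hypothesis hom : modulus omega.

Lemma Tpart_nearest i t : Tpart T x i t -> nearest x t i.
Proof. by move=> [[_ h] _] j; have [->//|] := eqVneq j i; exact: h. Qed.

Lemma Tpart_exists t : T t -> exists i, Tpart T x i t.
Proof.
move=> Tt; have [i [Ni hi]] := nearest_exists x t n0; exists i.
split; first by split.
move=> [j /= ji [_ hj]]; suff : (i <= j)%N by rewrite leqNgt ji.
by apply: hi => k; have [->//|] := eqVneq k j; exact: hj.
Qed.

Lemma Tpart_disjoint i j : i != j -> Tpart T x i `&` Tpart T x j = set0.
Proof.
move=> ij; apply/seteqP; split => // t [[hi ni] [hj nj]].
have [lij|lji|/ord_inj eij] := ltngtP (i : nat) j.
- by apply: nj; exists i.
- by apply: ni; exists j.
- by rewrite eij eqxx in ij.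
Qed.

Lemma PhiStarE i t (y : 'I_n -> X) : Tpart T x i t -> PhiStar T x y t = y i.
Proof.
move=> it; rewrite /PhiStar (bigD1 i)//= asboolT// big1 ?ladd_zero// => j ji.
rewrite asboolF// => jt; have : (Tpart T x j `&` Tpart T x i) t by [].
by rewrite Tpart_disjoint.
Qed.

Lemma measurable_Ttilde i : measurable (Ttilde T x i : set (Rd R d)).
Proof.
have mT := compact_measurable_Rd cT.
have -> : Ttilde T x i = (\bigcap_(j in [set j | j != i])
    (T `&` [set t : Rd R d | eucl (x i) t <= eucl (x j) t])) `&` T.
  apply/seteqP; split => [t [Tt h]|t [h Tt]].
    by split => // j ji; split => //=; rewrite !(euclC (x _)); exact: h.
  by split => // j ji; have [_ /=] := h j ji; rewrite !(euclC (x _)).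
apply: measurableI => //; apply: fin_bigcap_measurable => [|j _].
  exact: finite_finset.
by apply: measurable_le_set => //; apply: (@measurable_funS _ _ _ _ setT) => //;
  exact: measurable_eucl.
Qed.

Lemma measurable_Tpart i : measurable (Tpart T x i : set (Rd R d)).
Proof.
apply: measurableD; first exact: measurable_Ttilde.
apply: fin_bigcup_measurable => [|j _]; first exact: finite_finset.
exact: measurable_Ttilde.
Qed.

Lemma PhiStar_in_B (y : 'I_n -> X) : in_B T (PhiStar T x y).
Proof.
split.
  exists (lzero X), (\sum_i hX X (y i) (lzero X)) => t Tt.
  have [i it] := Tpart_exists Tt; rewrite (PhiStarE _ it) (bigD1 i)//= lerDl.
  by apply: sumr_ge0 => j _; exact: hX_ge0.
move=> z; apply: (@partition_measurable_fun R d _ (fun i : 'I_n => Tpart T x i : set (Rd R d))).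
- exact: measurable_Tpart.
- by move=> i t [[]].
- exact: Tpart_exists.
- move=> i; apply: (@eq_measurable_fun _ _ _ _ _ (cst (hX X (y i) z))) => // t.
  by rewrite inE => it; rewrite (PhiStarE _ it).
Qed.

Variable eps : R.
Hypothesis eps0 : 0 < eps.
Hypothesis BT : forall i, cball (x i) eps `<=` T.

Local Notation B := (fun i : 'I_n => cball (x i) eps : set (Rd R d)).

Lemma in_H_in_B_cball (f : Rd R d -> X) i : in_H T omega f -> in_B (B i) f.
Proof.
move=> hf; apply: (in_H_in_B hom (M := 2 * eps)); first by move=> s t; exact: cball_diam.
by move=> s t Bs Bt; exact: (hf s t (BT Bs) (BT Bt)).
Qed.

(** P(f(t)) is the mean over the ball of the constant f(t), so homogeneity of the metric reduces the
    claim to [integral_on_le] with z = f(t). *)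
Lemma info_le f t i : in_H T omega f -> T t ->
  hX X (P (f t)) (info P mu T B f i) <= avgw mu eps omega (x i) t.
Proof.
move=> hf Tt; have mB := measurable_cball (x i) eps.
have m0 := fine_cball_gt0 hmu (x i) eps0.
rewrite /info -[P (f t)]lsmul_one -(mulVf (lt0r_neq0 m0)) -lsmul_mul hX_smul.
rewrite ger0_norm ?invr_ge0 ?(ltW m0)// /avgw /avg ler_pM2l ?invr_gt0//.
have fB := in_H_in_B_cball i hf.
apply: (le_trans (integral_on_le hP (compact_measurable_Rd cT) (compact_lty cT hmu) (f t) mB (@BT i) fB)).
apply: le_Rintegral => //.
- apply: (mod_cont_cball_integrable hmu eps0 hom) => s s' Bs Bs'.
  rewrite !(hX_sym (f t)); exact: (mod_cont_hX (f t) hf (BT Bs) (BT Bs')).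
- exact: avgw_integrable.
- by move=> s Bs; exact: (hf t s Tt (BT Bs)).
Qed.

(** The bound is finite and itself has modulus of continuity [omega], so it attains its maximum on
    the compact set T. *)
Lemma bound_fun_attains_max : T !=set0 -> exists t0, T t0 /\ forall t, T t ->
  (bound_fun mu omega B t <= bound_fun mu omega B t0)%E.
Proof.
move=> T0; pose b t := fine (bound_fun mu omega B t).
have bE t : bound_fun mu omega B t = (b t)%:E.
  by have [i [/(bound_fun_nearest hmu eps0 hom) h _]] := nearest_exists x t n0; rewrite /b h.
(* The mean at s over the ball nearest to t is at least the minimum at s, and moving from s to t
   changes this mean by at most omega(r(s,t)). *)
have bD s t : b s <= b t + omega (eucl s t).
  have [i [Ni _]] := nearest_exists x s n0; have [j [Nj _]] := nearest_exists x t n0.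
  rewrite /b (bound_fun_nearest hmu eps0 hom Ni) (bound_fun_nearest hmu eps0 hom Nj) /=.
  apply: (le_trans (avgw_le hmu eps0 hom (Ni j))).
  by have := avgw_dist hmu eps0 hom (x j) s t; rewrite ler_distl => /andP[_]; rewrite addrC.
have [|c] := @compact_EVT_max _ R b T T0 cT.
  apply: ucont_within; apply: (mod_cont_ucont hom) => s t _ _.
  by rewrite ler_distl lerBlDr bD {1}euclC bD.
by rewrite inE => Tc hc; exists c; split => // t Tt; rewrite !bE lee_fin hc// inE.
Qed.

Lemma PhiStar_error_le t0 : T t0 ->
  (forall t, T t -> (bound_fun mu omega B t <= bound_fun mu omega B t0)%E) ->
  (method_error P mu T omega B (PhiStar T x) <= bound_fun mu omega B t0)%E.
Proof.
move=> Tt0 hmax; apply: ge_ereal_sup => _ [f [t [hf [Tt ->]]]].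
apply: (le_trans _ (hmax t Tt)); have [i it] := Tpart_exists Tt.
rewrite (PhiStarE _ it) (bound_fun_nearest hmu eps0 hom (Tpart_nearest it)) lee_fin.
exact: info_le.
Qed.

Lemma PhiStar_is_method : is_method P mu T omega B (PhiStar T x).
Proof. by move=> f _; exact: PhiStar_in_B. Qed.

Lemma optimal_error_le_PhiStar :
  (optimal_error P mu T omega B <= method_error P mu T omega B (PhiStar T x))%E.
Proof. by apply: ereal_inf_lbound; exists (PhiStar T x) => //; exact: PhiStar_is_method. Qed.

End VoronoiMethod.

(** * The real line inside an L-space *)

Section RealLine.
Variable R : realType.

Lemma real_complete (u : nat -> R) :
  (forall e, 0 < e -> exists N, forall m k, (N <= m)%N -> (N <= k)%N -> `|u m - u k| < e) ->
  exists l, (fun k => `|u k - l|) @ \oo --> 0.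
Proof.
move=> cu; have /cauchy_cvg cv : cauchy (u @ \oo).
  apply: cauchy_exP => e e0; have [N hN] := cu e e0; exists (u N).
  by exists N => // m /= Nm; exact: hN.
exists (lim (u @ \oo)); apply/cvgrPdist_lt => e e0.
move/cvgrPdist_lt : cv => /(_ e e0); apply: filterS => k.
by rewrite sub0r normrN normr_id distrC.
Qed.

Lemma real_separable : exists D : nat -> R, forall x e : R, 0 < e -> exists k, `|D k - x| < e.
Proof.
exists (fun k => if unpickle k is Some q then ratr q else 0) => x e e0.
have [|q] := @rat_in_itvoo R (x - e) (x + e); first by lra.
rewrite in_itv/= => /andP[h1 h2]; exists (pickle q); rewrite pickleK.
by rewrite ltr_distl h1 h2.
Qed.

Lemma real_dist_eq0 (x y : R) : `|x - y| = 0 <-> x = y.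
Proof.
split=> [/eqP|->]; last by rewrite subrr normr0.
by rewrite normr_eq0 subr_eq0 => /eqP.
Qed.

Lemma real_smul_dist (a x y : R) : `|a * x - a * y| = `|a| * `|x - y|.
Proof. by rewrite -mulrBr normrM. Qed.

Lemma real_add_dist (x y z : R) : `|x + z - (y + z)| <= `|x - y|.
Proof. by rewrite opprD addrACA subrr addr0. Qed.

(** Makes the approximation results above available for scalar functions, the identity taking the
    place of the convexifying operator. *)
Definition real_LSpace : LSpace R := {|
  lcar := R; ladd := +%R; lsmul := *%R; lzero := 0; hX := fun x y => `|x - y|;
  ladd_comm := @addrC R; ladd_assoc := @addrA R; ladd_zero := @addr0 R;
  lsmul_addr := @mulrDr R; lsmul_mul := @mulrA R; lsmul_one := @mul1r R; lsmul_zero := @mul0r R;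
  hX_eq0 := real_dist_eq0; hX_sym := @distrC R R;
  hX_tri := fun x y z => ler_distD y x z;
  hX_complete := real_complete; hX_separable := real_separable;
  hX_smul := real_smul_dist; hX_add := real_add_dist |}.

End RealLine.

Section Line.
Variables (R : realType) (X : LSpace R).
Hypothesis iso : isotropic X.
Variables (x x' : X).
Hypothesis xx' : ladd X x x' = lzero X.
Hypothesis cx : is_convex_elt x.
Hypothesis x1 : hX X x (lzero X) = 1.

Local Notation "a +^ b" := (ladd X a b) (at level 50, left associativity).
Local Notation "a *^ b" := (lsmul X a b) (at level 40, left associativity).

(** Add a(x + x') and b(x + x'), both zero, to (a + b)x'. Convexity merges ax + bx into (a + b)x,
    which cancels (a + b)x' and leaves ax' + bx'. *)
Lemma inverse_convex : is_convex_elt x'.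
Proof.
move=> a b a0 b0.
have h c : c *^ x +^ c *^ x' = lzero X by rewrite -lsmul_addr xx' lsmul_lzero.
rewrite -[LHS]ladd_zero -(h a) -[LHS]ladd_zero -(h b) -ladd_assoc.
rewrite [X in _ +^ X](_ : _ = ((a + b) *^ x) +^ (a *^ x' +^ b *^ x')).
  by rewrite ladd_assoc (ladd_comm _ ((a + b) *^ x)) h ladd0l.
by rewrite cx// [RHS]Monoid.mulmACA.
Qed.

(** Stands for the formal difference p - q of nonnegative numbers; by [J_eq] it depends on that
    difference only. *)
Let J (p q : R) := p *^ x +^ q *^ x'.

Let J_add p q r s : 0 <= p -> 0 <= q -> 0 <= r -> 0 <= s -> J p q +^ J r s = J (p + r) (q + s).
Proof. by move=> p0 q0 r0 s0; rewrite /J cx// inverse_convex// [LHS]Monoid.mulmACA. Qed.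

Let J_diag p : J p p = lzero X.
Proof. by rewrite /J -lsmul_addr xx' lsmul_lzero. Qed.

Let J_eq p q r s : 0 <= p -> 0 <= q -> 0 <= r -> 0 <= s -> p + s = r + q -> J p q = J r s.
Proof.
move=> p0 q0 r0 s0 e.
rewrite -[LHS]ladd_zero -(J_diag s) J_add// e -[RHS]ladd_zero -(J_diag q) J_add//.
by rewrite (addrC q).
Qed.

(* a |-> a x for a >= 0 and a |-> |a| x' for a <= 0; note that (-1) x need not be the
   inverse of x in a semilinear space. *)
Definition line (a : R) : X := Num.max a 0 *^ x +^ Num.max (- a) 0 *^ x'.

Let max0 (a : R) : 0 <= Num.max a 0. Proof. by rewrite le_max lexx orbT. Qed.

Let maxB (a : R) : Num.max a 0 - Num.max (- a) 0 = a.
Proof. by rewrite !maxElt; do 2 case: ltP => ?; lra. Qed.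

Lemma lineD a b : line (a + b) = line a +^ line b.
Proof.
rewrite /line -/(J _ _) -/(J (Num.max a 0) _) -/(J (Num.max b 0) _) J_add//.
apply: J_eq => //; [exact: addr_ge0|exact: addr_ge0|].
by have := maxB a; have := maxB b; have := maxB (a + b); lra.
Qed.

Lemma lineZ c a : 0 <= c -> line (c * a) = c *^ line a.
Proof.
move=> c0; rewrite /line lsmul_addr !lsmul_mul -/(J _ _) -/(J (c * _) _).
apply: J_eq => //; [exact: mulr_ge0|exact: mulr_ge0|].
have := maxB a => /(congr1 (fun z => c * z)); have := maxB (c * a); rewrite mulrBr; lra.
Qed.

Lemma line0 : line 0 = lzero X.
Proof. by rewrite /line oppr0 maxxx !lsmul_zero ladd_zero. Qed.

Lemma line_convex a : is_convex_elt (line a).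
Proof.
by move=> b c b0 c0; rewrite -!lineZ ?addr_ge0// mulrDl lineD.
Qed.

Let line_pos a : 0 <= a -> hX X (line a) (lzero X) = a.
Proof.
move=> a0; rewrite /line max_l// max_r ?oppr_le0// lsmul_zero ladd_zero.
by rewrite -(lsmul_lzero X a) hX_smul x1 mulr1 ger0_norm.
Qed.

(** Isotropy allows adding [line (- b)] to both points, which leaves a distance to zero. For a
    negative parameter c, adding [line (- c)] reduces to the positive half-line, where [x1] gives
    the length. *)
Lemma line_dist a b : hX X (line a) (line b) = `|a - b|.
Proof.
have dist0 c : hX X (line c) (lzero X) = `|c|.
  have [c0|c0] := leP 0 c; first by rewrite line_pos// ger0_norm.
  rewrite -(iso _ _ (line (- c))) -lineD subrr line0 ladd0l hX_sym line_pos ?oppr_ge0 ?ltW//.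
  by rewrite ltr0_norm.
by rewrite -(iso _ _ (line (- b))) -!lineD subrr line0 dist0.
Qed.

Lemma line_sum (I : Type) (r : seq I) (F : I -> R) :
  line (\sum_(i <- r) F i) = \big[ladd X/lzero X]_(i <- r) line (F i).
Proof. by elim: r => [|i r ih]; rewrite ?big_nil ?line0// !big_cons lineD ih. Qed.

End Line.

(** * Scalar integrals carried along the line *)

Section LineIntegral.
Variables (R : realType) (X : LSpace R) (P : X -> X) (d : nat).
Variables (mu : {measure set (Rd R d) -> \bar R}) (T : set (Rd R d)).
Hypothesis hP : convexifying P.
Hypothesis mT : measurable T.
Hypothesis Too : (mu T < +oo)%E.
Hypothesis iso : isotropic X.
Variables (x x' : X).
Hypothesis xx' : ladd X x x' = lzero X.
Hypothesis cx : is_convex_elt x.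
Hypothesis x1 : hX X x (lzero X) = 1.

Local Notation RL := (real_LSpace R).

Lemma sd_int_real (s : sdecomp RL d) (G : Rd R d -> RL) : sd_ok T s -> in_B T G ->
  `|sd_int id mu s - \int[mu]_(t in T) G t| <= sd_err mu T s G.
Proof.
move=> ok GB.
have -> : sd_int id mu s = \int[mu]_(t in T) (sd_eval s t : R).
  rewrite (@partition_Rintegral R d mu _ (fun i : 'I_(sd_k s) => sd_A s i) _ _ _ _ _ _
    (fun i => sd_v s i))//.
  - by apply: eq_bigr => i _; rewrite /= mulrC.
  - by move=> i; have [] := ok.1 i (ltn_ord i).
  - by move=> i; have [] := ok.1 i (ltn_ord i).
  - by move=> i j ij; apply: ok.2.1 => // /ord_inj e; rewrite e eqxx in ij.
  - by move=> t Tt; have [i Ai] := sd_cover ok Tt; exists i.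
  - by move=> i t Ai; rewrite (sd_evalE ok _ Ai).
(* Membership in [in_B] gives measurability of distances to points only. As g >= -K, the distance
   from g to -K is g + K, and g is measurable. *)
have bi (g : Rd R d -> RL) : in_B T g -> mu.-integrable T (EFin \o (g : Rd R d -> R)).
  move=> [[x0 [C gC]] mg]; pose K := C + `|x0 : R|.
  have gK t : T t -> `|g t : R| <= K.
    move=> Tt; rewrite -[g t : R](subrK (x0 : R)) (le_trans (ler_normD _ _))// lerD2r.
    exact: gC.
  apply: (@bounded_integrable _ _ _ _ _ K) => //.
  have /measurable_funB/(_ (@measurable_cst _ _ _ _ T K)) := mg (- K : R).
  apply: eq_measurable_fun => t; rewrite inE => /gK; rewrite ler_norml => /andP[h _] /=.
  by rewrite opprK ger0_norm ?addrK// -lerBlDr sub0r.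
have i1 := bi _ (sd_in_B mT ok); have i2 := bi _ GB.
rewrite -RintegralB//; apply: le_normr_Rintegral => //.
exact: (integrableB mT i1 i2).
Qed.

Local Notation line := (line x x').

(** [line] is an isometry, so it sends simple approximations of g to simple approximations of its
    image. It is additive, positively homogeneous and convex-valued, so their integrals are the
    images of scalar integrals, which tend to 0. *)
Lemma integral_on_line (Q : set (Rd R d)) (g : Rd R d -> R) : measurable Q -> Q `<=` T ->
  in_B Q (g : Rd R d -> RL) -> in_B Q (fun t => line (g t)) ->
  \int[mu]_(t in Q) g t = 0 ->
  integral_on P mu T Q (fun t => line (g t)) = lzero X.
Proof.
move=> mQ QT gB lB g0; pose G : Rd R d -> RL := indf Q (g : Rd R d -> RL).
have GB : in_B T G by exact: indf_in_B.
have IG : \int[mu]_(t in T) (G t : R) = 0.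
  rewrite -g0 (Rintegral_mkcond _ Q) Rintegral_mkcond; apply: eq_Rintegral => t _; rewrite !patchE.
  case: ifPn => [|]; rewrite ?inE ?notin_setE => Tt; case: ifPn => [|]; rewrite ?inE ?notin_setE => Qt //.
  - by rewrite /G /indf asboolT.
  - by rewrite /G /indf asboolF.
  - by case: Tt; exact: QT.
have [sq ap] := approx_seq_exists mu mT GB.
pose sql m := SDecomp (sd_k (sq m)) (fun i => line (sd_v (sq m) i)) (sd_A (sq m)).
have evalE m t : sd_eval (sql m) t = line (sd_eval (sq m) t : R).
  rewrite /sd_eval line_sum//; apply: eq_bigr => i _ /=.
  by case: ifP => // _; rewrite line0.
have intE m : sd_int P mu (sql m) = line (sd_int id mu (sq m) : R).
  rewrite /sd_int line_sum//; apply: eq_bigr => i _ /=.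
  by rewrite (convexifying_id hP) ?lineZ ?fine_ge0//; exact: line_convex.
have indE t : indf Q (fun t => line (g t)) t = line (G t : R).
  by rewrite /G /indf; case: ifP => // _; rewrite line0.
have [ok [[x0 [C sC]] [N [mN [N0 cv]]]]] := ap.
apply: (@integral_eq _ _ _ _ _ _ hP mT Too _ sql) => //; first exact: indf_in_B.
  split => //; split.
    by exists (line (x0 : R)), C => m t Tt; rewrite evalE line_dist//; exact: sC.
  exists N; split => //; split => // t Tt Nt.
  rewrite (_ : (fun m => _) = (fun m => `|(sd_eval (sq m) t : R) - G t|)); first exact: cv.
  by apply/funext => m; rewrite evalE [X in hX _ _ X](indE t) line_dist.
rewrite (_ : (fun m => _) = (fun m => `|(sd_int id mu (sq m) : R)|)); last first.
  by apply/funext => m; rewrite intE -(line0 x x') line_dist// subr0.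
apply: (squeeze_cvgr _ (cvg_cst 0) (sd_err_cvg mT Too ap GB)); apply: nearW => m.
by rewrite normr_ge0/=; have := sd_int_real (ok m) GB; rewrite IG subr0.
Qed.

End LineIntegral.

(** * Sharpness *)

Section ExtremalFunction.
Variables (R : realType) (d : nat) (mu : {measure set (Rd R d) -> \bar R}).
Hypothesis hmu : is_lebesgue mu.
Variables (omega : R -> R) (eps : R).
Hypothesis hom : modulus omega.
Hypothesis eps0 : 0 < eps.

Lemma max_dist (a b a' b' w : R) : `|a - a'| <= w -> `|b - b'| <= w ->
  `|Num.max a b - Num.max a' b'| <= w.
Proof.
rewrite !ler_norml => /andP[h1 h2] /andP[h3 h4].
by case: (leP a b) => ?; case: (leP a' b') => ?; apply/andP; split; lra.
Qed.

Lemma mod_cont_max D (g h : Rd R d -> R) : mod_cont omega D g -> mod_cont omega D h ->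
  mod_cont omega D (fun s => Num.max (g s) (h s)).
Proof. by move=> mg mh s t Ds Dt; apply: max_dist; [exact: mg|exact: mh]. Qed.

Lemma mod_cont_bigmax (I : Type) (r : seq I) D (g : Rd R d -> R) (h : I -> Rd R d -> R) :
  mod_cont omega D g -> (forall i, mod_cont omega D (h i)) ->
  mod_cont omega D (fun s => \big[Num.max/g s]_(i <- r) h i s).
Proof.
move=> mg mh; elim: r => [|i r ih]; first by under eq_fun do rewrite big_nil.
by under eq_fun do rewrite big_cons; exact: mod_cont_max.
Qed.

Lemma mod_cont_cst (D : set (Rd R d)) (c : R) : mod_cont omega D (fun=> c).
Proof. by move=> s t _ _; rewrite subrr normr0 (modulus_ge0 hom)// eucl_ge0. Qed.

Lemma mod_cont_sub D (c : R) (g : Rd R d -> R) : mod_cont omega D g -> mod_cont omega D (fun s => c - g s).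
Proof. by move=> mg s t Ds Dt; rewrite opprB addrC addrA subrK distrC; exact: mg. Qed.

Variables (t0 : 'rV[R]_d) (m : R).
Hypothesis m0 : 0 <= m.

Let g0 (s : Rd R d) : R := m - omega (eucl t0 s).

Let mod_g0 D : mod_cont omega D g0.
Proof. by apply: mod_cont_sub; exact: mod_cont_eucl. Qed.

(** Intermediate values for the mean F(c) of max(g0, c), which is 1-Lipschitz in c and nonnegative
    at c = 0. At c = -omega(2 eps): if g0 is positive somewhere on the ball, it stays above c there,
    truncation changes nothing, and the mean is m - [avgw] <= 0; otherwise the truncated function is
    nonpositive. *)
Lemma balancing_level (p : 'rV[R]_d) : m <= avgw mu eps omega p t0 ->
  exists c, [/\ - omega (2 * eps) <= c, c <= 0 & avg mu eps p (fun s => Num.max (g0 s) c) = 0].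
Proof.
move=> mp; pose F c := avg mu eps p (fun s => Num.max (g0 s) c).
have w0 : 0 <= omega (2 * eps) by apply: modulus_ge0 => //; rewrite mulr_ge0// ltW.
have im c : mu.-integrable (cball p eps : set (Rd R d)) (EFin \o (fun s => Num.max (g0 s) c)).
  by apply: (mod_cont_cball_integrable hmu eps0 hom); apply: mod_cont_max; [exact: mod_g0|exact: mod_cont_cst].
have FL c c' : `|F c - F c'| <= `|c - c'|.
  by apply: avg_dist => // s _; apply: max_dist; rewrite ?subrr ?normr0.
have cF : continuous F.
  move=> c; apply/cvgrPdist_lt => e e0; apply/nbhs_ballP; exists e => // c' cc'.
  exact: le_lt_trans (FL _ _) cc'.
have F0 : 0 <= F 0.
  rewrite -[leLHS](avg_cst hmu eps0 p 0); apply: avg_le => //; first exact: cst_integrable.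
  by move=> s _; rewrite le_max lexx orbT.
have Fw : F (- omega (2 * eps)) <= 0.
  have [[s [Bs gs]]|h] := pselect (exists s, cball p eps s /\ 0 < g0 s); last first.
    rewrite -[leRHS](avg_cst hmu eps0 p 0); apply: avg_le => //; first exact: cst_integrable.
    move=> s Bs; rewrite ge_max oppr_le0 w0 andbT leNgt; apply/negP => gs.
    by apply: h; exists s.
  have i0 : mu.-integrable (cball p eps : set (Rd R d)) (EFin \o g0).
    exact: (mod_cont_cball_integrable hmu eps0 hom).
  have -> : F (- omega (2 * eps)) = avg mu eps p g0.
    congr (_ * _); apply: eq_Rintegral => s'; rewrite inE => Bs'.
    apply: max_l; have := mod_g0 (D := setT) (s := s) (t := s') I I.
    have := modulus_le hom (eucl_ge0 s s') (cball_diam Bs Bs').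
    by rewrite ler_norml => h1 /andP[_ h2]; lra.
  have : avg mu eps p g0 + avgw mu eps omega p t0 = m.
    rewrite -avgD//; last exact: avgw_integrable.
    by under eq_fun do rewrite subrK; exact: avg_cst.
  by lra.
have [|||c] := @IVT R F (- omega (2 * eps)) 0 0.
- by rewrite oppr_le0.
- exact: continuous_subspaceT.
- by rewrite ge_min Fw le_max F0 orbT.
by rewrite in_itv/= => /andP[h1 h2] Fc; exists c.
Qed.

Variables (n : nat) (x : 'I_n -> 'rV[R]_d).
Hypothesis xsep : forall i j, x i != x j -> 4 * eps <= eucl (x i) (x j).
Hypothesis mx : forall i, m <= avgw mu eps omega (x i) t0.

(** The function is the maximum of g0 and all [psi i]. On the ball about x_i, [psi i] is the
    constant c_i. The ball is at distance at least 3 eps from any other centre x_j, so there [psi j]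
    <= -omega(2 eps) <= c_i, and only max(g0, c_i) remains. At t0 every [psi i] is at most 0 <= m =
    g0(t0). *)
Lemma extremal_function : exists g : Rd R d -> R,
  [/\ mod_cont omega setT g, g t0 = m & forall i, avg mu eps (x i) g = 0].
Proof.
(* The level is chosen as a function of the centre and not of the index, so that coinciding centres
   share it. *)
have /choice[c hc] : forall p : 'rV[R]_d, exists c, m <= avgw mu eps omega p t0 ->
    [/\ - omega (2 * eps) <= c, c <= 0 & avg mu eps p (fun s => Num.max (g0 s) c) = 0].
  move=> p; have [/balancing_level[c hc]|h] := pselect (m <= avgw mu eps omega p t0).
    by exists c.
  by exists 0 => /h.
pose psi (i : 'I_n) (s : Rd R d) := c (x i) - omega (Num.max (eucl (x i) s - eps) 0).
have max0 a : 0 <= Num.max a 0 :> R by rewrite le_max lexx orbT.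
have psi_le i s : psi i s <= c (x i) by rewrite /psi gerBl modulus_ge0.
exists (fun s => \big[Num.max/g0 s]_(i < n) psi i s); split.
- apply: mod_cont_bigmax => [|i]; first exact: mod_g0.
  apply: mod_cont_sub => s t _ _.
  apply: (le_trans (modulus_dist hom (max0 _) (max0 _))); apply: modulus_le => //.
  apply: max_dist; last by rewrite subrr normr0 eucl_ge0.
  rewrite (_ : _ - _ = eucl (x i) s - eucl (x i) t); last by ring.
  exact: eucl_dist.
- have g00 : g0 t0 = m by rewrite /g0 euclxx (modulus0 hom) subr0.
  apply/le_anti/andP; split; last by rewrite -{1}g00; exact: bigmax_ge_id.
  apply: bigmax_le; first by rewrite g00.
  by move=> i _; have [_ ci _] := hc _ (mx i); exact: le_trans (psi_le _ _) (le_trans ci m0).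
- move=> i; have [ci1 ci2 ci3] := hc _ (mx i).
  rewrite -ci3; congr (_ * _); apply: eq_Rintegral => s; rewrite inE => Bs.
  have Bs' : eucl s (x i) <= eps by [].
  have psii : psi i s = c (x i).
    by rewrite /psi max_r ?(modulus0 hom) ?subr0// subr_le0 euclC.
  apply/le_anti/andP; split; last first.
    rewrite ge_max bigmax_ge_id/= -psii; exact: le_bigmax.
  apply: bigmax_le; first by rewrite le_max lexx.
  move=> j _; rewrite le_max; apply/orP; right.
  have [->|xji] := eqVneq (x i) (x j); first exact: psi_le.
  have [cj1 cj2 _] := hc _ (mx j).
  apply: le_trans ci1; rewrite /psi; apply: (@le_trans _ _ (- omega (Num.max (eucl (x j) s - eps) 0))).
    by rewrite gerDr.
  rewrite lerN2; apply: modulus_le => //; first by rewrite mulr_ge0// ltW.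
  rewrite le_max; apply/orP; left.
  have := xsep xji; have := eucl_triangle s (x i) (x j); rewrite (euclC (x i) s) (euclC (x j) s); lra.
Qed.

End ExtremalFunction.

(** * The lower bound for an arbitrary method *)

Section LowerBound.
Variables (R : realType) (X : LSpace R) (P : X -> X) (d : nat) (T : set 'rV[R]_d).
Variables (mu : {measure set (Rd R d) -> \bar R}) (omega : R -> R) (n : nat) (x : 'I_n -> 'rV[R]_d).
Hypothesis hP : convexifying P.
Hypothesis n0 : (0 < n)%N.
Hypothesis cT : compact T.
Hypothesis hmu : is_lebesgue mu.
Hypothesis hom : modulus omega.
Hypothesis iso : isotropic X.
Variable eps : R.
Hypothesis eps0 : 0 < eps.
Hypothesis BT : forall i, cball (x i) eps `<=` T.
Hypothesis xsep : forall i j, x i != x j -> 4 * eps <= eucl (x i) (x j).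

Local Notation B := (fun i : 'I_n => cball (x i) eps : set (Rd R d)).

Lemma unit_invertible_convex : inv_conv_nontrivial X ->
  exists u u' : X, [/\ ladd X u u' = lzero X, is_convex_elt u & hX X u (lzero X) = 1].
Proof.
move=> [v [[v' vv'] [cv v0]]].
have h0 : 0 < hX X v (lzero X).
  by rewrite lt_neqAle hX_ge0 andbT eq_sym; apply/eqP => /hX_eq0.
pose k := (hX X v (lzero X))^-1; have k0 : 0 < k by rewrite invr_gt0.
exists (lsmul X k v), (lsmul X k v'); split.
- by rewrite -lsmul_addr vv' lsmul_lzero.
- by move=> a b a0 b0; rewrite !lsmul_mul mulrDl cv// mulr_ge0// ltW.
- by rewrite -{1}(lsmul_lzero X k) hX_smul gtr0_norm// mulVf// gt_eqF.
Qed.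

(** The images of g and -g on the line have zero information, so [Phi] returns the same y for both
    at t0. The values [line m] and [line (- m)] are 2m apart, hence y is at distance at least m from
    one of them. Both are convex, so [P] fixes them. *)
Lemma bound_fun_le_method_error t0 Phi : inv_conv_nontrivial X -> T t0 ->
  (bound_fun mu omega B t0 <= method_error P mu T omega B Phi)%E.
Proof.
move=> /unit_invertible_convex[u [u' [uu' cu u1]]] Tt0.
have [i [Ni _]] := nearest_exists x t0 n0.
rewrite (bound_fun_nearest hmu eps0 hom Ni); set m := avgw _ _ _ _ _.
have [g [mg gt0 gavg]] := extremal_function hmu hom eps0 (avgw_ge0 mu eps hom (x i) t0) xsep
  (fun j => avgw_le hmu eps0 hom (Ni j)).
pose line := line u u'.
have key (h : Rd R d -> R) : mod_cont omega setT h -> (forall i, avg mu eps (x i) h = 0) ->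
    in_H T omega (fun t => line (h t)) /\ info P mu T B (fun t => line (h t)) = fun=> lzero X.
  move=> mh havg.
  have hH : in_H T omega (fun t => line (h t)) by move=> s t _ _; rewrite line_dist//; exact: mh.
  split => //; apply/funext => j; rewrite /info.
  rewrite (integral_on_line hP (compact_measurable_Rd cT) (compact_lty cT hmu) iso uu' cu u1)//.
  - exact: lsmul_lzero.
  - exact: measurable_cball.
  - apply: (in_H_in_B hom (M := 2 * eps)); first by move=> s t; exact: cball_diam.
    by move=> s t _ _; exact: mh.
  - exact: (in_H_in_B_cball hom BT).
  - have /eqP := havg j; rewrite mulf_eq0 invr_eq0 gt_eqF ?fine_cball_gt0//=.
    by move/eqP.
have mN : mod_cont omega setT (fun s => 0 - g s) by exact: mod_cont_sub.
have [H1 I1] := key _ mg gavg.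
have avgN j : avg mu eps (x j) (fun s => 0 - g s) = 0.
  have ig h : mod_cont omega setT h -> mu.-integrable (B j) (EFin \o h).
    by move=> mh; apply: (mod_cont_cball_integrable hmu eps0 hom) => s t _ _; exact: mh.
  have := avgD (ig _ mN) (ig _ mg); rewrite gavg addr0 => <-.
  by under eq_fun do rewrite subrK; exact: avg_cst.
have [H2 I2] := key _ mN avgN.
have PL a : P (line a) = line a by apply: (convexifying_id hP); exact: line_convex.
have lb f : in_H T omega f -> ((hX X (P (f t0)) (Phi (info P mu T B f) t0))%:E <=
    method_error P mu T omega B Phi)%E.
  by move=> Hf; apply: ereal_sup_ubound; exists f, t0.
have := lb _ H1; have := lb _ H2; rewrite I1 I2 !PL gt0 sub0r -/m; set y := Phi _ _.
have : 2 * m <= hX X (line m) y + hX X (line (- m)) y.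
  rewrite (hX_sym (line (- m))); apply: le_trans (hX_tri _ y _).
  by rewrite line_dist//; apply: le_trans (ler_norm _); lra.
have [h _ _ +|h h2 + _] := leP m (hX X (line m) y); first by apply: le_trans; rewrite lee_fin.
by apply: le_trans; rewrite lee_fin; lra.
Qed.

End LowerBound.

Lemma separation_radius (R : realType) (d n : nat) (x : 'I_n -> 'rV[R]_d) :
  exists2 e : R, 0 < e & forall i j, x i != x j -> 4 * e <= eucl (x i) (x j).
Proof.
(* The initial value 1 is the answer when all centres coincide. *)
exists (\big[Num.min/1]_(ij : 'I_n * 'I_n | x ij.1 != x ij.2) (eucl (x ij.1) (x ij.2) / 4)).
  elim/big_ind: _ => // [a b a0 b0|ij xij]; first by rewrite lt_min a0.
  by rewrite divr_gt0// eucl_gt0.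
move=> i j xij; rewrite mulrC -ler_pdivlMr//.
by rewrite (bigD1 (i, j))//= ge_min lexx.
Qed.

Unset Implicit Arguments.

Theorem theorem6 (R : realType) (X : LSpace R) (P : X -> X) (d : nat)
    (T : set 'rV[R]_d) (mu : {measure set (Rd R d) -> \bar R})
    (omega : R -> R) (n : nat) (x : 'I_n -> 'rV[R]_d) :
  convexifying P ->
  (0 < d)%N -> (0 < n)%N ->
  convex_subset T -> compact T ->
  is_lebesgue mu ->
  modulus omega ->
  (forall i, T (x i)) ->
  (* the estimate, for every radius eps > 0 with B_i \subset T *)
  (forall eps : R, 0 < eps -> (forall i, cball (x i) eps `<=` T) ->
     exists t0, T t0 /\
       (forall t, T t -> (bound_fun mu omega (fun i => cball (x i) eps) t
                         <= bound_fun mu omega (fun i => cball (x i) eps) t0)%E) /\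
       (optimal_error P mu T omega (fun i => cball (x i) eps)
          <= bound_fun mu omega (fun i => cball (x i) eps) t0)%E)
  /\
  (* sharpness for small radii *)
  (isotropic X -> inv_conv_nontrivial X ->
   exists eps0 : R, 0 < eps0 /\
     forall eps : R, 0 < eps -> eps < eps0 -> (forall i, cball (x i) eps `<=` T) ->
       (exists t0, T t0 /\
         (forall t, T t -> (bound_fun mu omega (fun i => cball (x i) eps) t
                           <= bound_fun mu omega (fun i => cball (x i) eps) t0)%E) /\
         optimal_error P mu T omega (fun i => cball (x i) eps)
           = bound_fun mu omega (fun i => cball (x i) eps) t0) /\
       is_method P mu T omega (fun i => cball (x i) eps) (PhiStar T x) /\
       method_error P mu T omega (fun i => cball (x i) eps) (PhiStar T x)
         = optimal_error P mu T omega (fun i => cball (x i) eps)).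
Proof.
move=> hP d0 n0 convT cT hmu hom Tx.
have T0 : T !=set0 by exists (x (Ordinal n0)); exact: Tx.
split=> [eps eps0 BT|iso hX0].
  have [t0 [Tt0 hmax]] := bound_fun_attains_max x n0 cT hmu hom eps0 T0.
  exists t0; split => //; split => //.
  apply: (le_trans (@optimal_error_le_PhiStar _ X P _ _ mu omega _ x n0 cT eps)).
  exact: PhiStar_error_le.
have [e e0 xsep] := separation_radius x.
exists e; split => // eps eps0 epse BT.
have [t0 [Tt0 hmax]] := bound_fun_attains_max x n0 cT hmu hom eps0 T0.
have upper : (method_error P mu T omega (fun i => cball (x i) eps) (PhiStar T x) <=
    bound_fun mu omega (fun i => cball (x i) eps) t0)%E by exact: PhiStar_error_le.
have lower : (bound_fun mu omega (fun i => cball (x i) eps) t0 <=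
    optimal_error P mu T omega (fun i => cball (x i) eps))%E.
  apply: le_ereal_inf_tmp => _ [Phi _ <-]; apply: bound_fun_le_method_error => // i j xij.
  by apply: le_trans (xsep _ _ xij); rewrite ler_pM2l// ltW.
(* This closes the cycle bound <= optimal error <= error of the Voronoi method <= bound, so all
   three are equal. *)
have optle := @optimal_error_le_PhiStar _ X P _ _ mu omega _ x n0 cT eps.
split; last split.
- exists t0; split => //; split => //; apply/le_anti.
  by rewrite lower (le_trans optle upper).
- exact: PhiStar_is_method.
- by apply/le_anti; rewrite optle (le_trans upper lower).
Qed.
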